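(* For any $\rho>0$ and $\delta\in(0,1)$ there are $\beta>0$ and $C>0$ such that the following holds. For any distribution $D_X\in\mathcal{D}_\rho$ (in any dimension $d$) whose covariance matrix $\Sigma$ satisfies $\Sigma\preceq I$, and for any positive integer $m\le\beta\,\mathrm{tr}(\Sigma)-C$, if $X$ is the $m\times d$ matrix of a sample drawn from $D_X^m$, then \[ \mathbb{P}[\lambda_{\min}(XX^T)\ge m]\ge\delta. \]
   Context: A real random variable $Z$ is sub-Gaussian with relative moment $\rho>0$ if $\mathbb{E}[\exp(tZ)]\le\exp(t^2\rho^2\mathbb{E}[Z^2]/2)$ for all $t\in\mathbb{R}$. A distribution $D_X$ over $\mathbb{R}^d$ is a sub-Gaussian product distribution with relative moment $\rho$ if there is an orthonormal basis $a_1,\dots,a_d$ of $\mathbb{R}^d$ such that, for $X\sim D_X$, the variables $\langle a_i,X\rangle$ are independent and each is sub-Gaussian with relative moment $\rho$. $\mathcal{D}_\rho$ denotes the family of all such distributions, in arbitrary dimension. $\lambda_{\min}$ is the smallest eigenvalue; $\preceq$ is the Loewner order. *)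

(* Defs.v *)
From HB Require Import structures.
From mathcomp Require Import all_boot all_order all_algebra.
From mathcomp Require Import all_classical all_reals all_analysis.

Set Implicit Arguments.
Unset Strict Implicit.
Unset Printing Implicit Defensive.

Import Order.TTheory GRing.Theory Num.Theory.
Import numFieldNormedType.Exports.

Local Open Scope classical_set_scope.
Local Open Scope ring_scope.

Section defs.
Context (R : realType).

(* Borel sigma-algebra on R^d (represented as functions 'I_d -> R): the
   sigma-algebra generated by the coordinate preimages of Borel sets of R,
   i.e. the product (= Borel) sigma-algebra of R^d. *)
Definition borel_Rd (d : nat) : set (set ('I_d -> R)) :=
  <<s [set A | exists (k : 'I_d) (B : set R), measurable B /\
                 A = (fun v => v k) @^-1` B] >>.

Context (dT : measure_display) (T : measurableType dT) (P : probability T R).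

Definition rvec_measurable (d : nat) (V : T -> 'I_d -> R) : Prop :=
  forall k : 'I_d, measurable_fun setT (fun w => V w k).

Definition indep_real_RVs (n : nat) (Y : 'I_n -> T -> R) : Prop :=
  forall B : 'I_n -> set R, (forall i, measurable (B i)) ->
    P (\bigcap_(i in setT) (Y i @^-1` B i)) =
    (\big[*%E/1%E]_(i < n) P (Y i @^-1` B i))%E.

Definition indep_rvecs (m d : nat) (V : 'I_m -> T -> 'I_d -> R) : Prop :=
  forall A : 'I_m -> set ('I_d -> R), (forall j, borel_Rd (A j)) ->
    P (\bigcap_(j in setT) (V j @^-1` A j)) =
    (\big[*%E/1%E]_(j < m) P (V j @^-1` A j))%E.

Definition identically_distributed (m d : nat) (V : 'I_m -> T -> 'I_d -> R) :
    Prop :=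
  forall (j j' : 'I_m) (A : set ('I_d -> R)), borel_Rd A ->
    P (V j @^-1` A) = P (V j' @^-1` A).

Definition subgaussian_rel (Z : T -> R) (rho : R) : Prop :=
  [/\ measurable_fun setT Z,
      ('E_P[fun w => (Z w ^+ 2)%R] < +oo)%E &
      forall t : R,
        ('E_P[fun w => (expR (t * Z w))%R] <=
         (expR (t ^+ 2 * rho ^+ 2 * fine 'E_P[fun w => (Z w ^+ 2)%R] / 2))%:E)%E].

(* the law of V is a sub-Gaussian product distribution with relative moment
   rho: there is an orthonormal basis a_1..a_d (the rows of an orthogonal
   matrix A) such that the <a_i, V> are independent, each sub-Gaussian with
   relative moment rho *)
Definition subgaussian_product (d : nat) (V : T -> 'I_d -> R) (rho : R) : Prop :=
  exists A : 'M[R]_d, A *m A^T = 1%:M /\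
    let Y := fun (i : 'I_d) (w : T) => \sum_(k < d) A i k * V w k in
    indep_real_RVs Y /\ forall i, subgaussian_rel (Y i) rho.

Definition cov_matrix (d : nat) (V : T -> 'I_d -> R) : 'M[R]_d :=
  \matrix_(k, l) fine (covariance P (fun w => V w k) (fun w => V w l)).

Definition sample_matrix (m d : nat) (V : 'I_m -> T -> 'I_d -> R) (w : T) :
    'M[R]_(m, d) := \matrix_(j, k) V j w k.

End defs.

Definition loewner_le (R : realType) (n : nat) (A B : 'M[R]_n) : Prop :=
  forall v : 'rV[R]_n, (v *m A *m v^T) 0 0 <= (v *m B *m v^T) 0 0.

Definition lambda_min (R : realType) (n : nat) (A : 'M[R]_n) : R :=
  inf [set a : R | eigenvalue A a].

(* Main.v *)
(* Put the sample in the coordinates of the common basis: Z_ji = <a_i, X_j> are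
   independent, with variances s_i <= 1 summing to tr(Sigma), and for theta in
   R^m the form q(theta) = theta X X^T theta^T is the sum over i of
   (sum_j theta_j Z_ji)^2. Each inner sum is again sub-Gaussian, so its fourth
   moment is controlled by its variance; this bounds E exp(- tau T^2), and by
   independence over i the probability of q(theta) <= |theta|^2 tr(Sigma) / 2 is
   exponentially small in tr(Sigma).

   To reach all unit vectors, use the lattice h Z^m with h^2 = eta / (16 m)
   instead of a generic net. Rounding a unit vector coordinatewise at random,
   without bias, increases q on average by at most h^2 tr(X X^T) / 4, so some
   lattice point within h in each coordinate does no worse. By Markov's
   inequality tr(X X^T) <= (2 / eta) m tr(Sigma) with probability
   1 - eta / 2, which makes the loss at most tr(Sigma) / 32; the operator norm
   of X X^T is never estimated. At most exp(O(m)) lattice points are relevant,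
   so a union bound over them suffices once m <= beta tr(Sigma) - C. *)
Require Import Defs.
From HB Require Import structures.
From mathcomp Require Import all_boot all_order all_algebra.
From mathcomp Require Import all_classical all_reals all_analysis.
From mathcomp Require Import measurable_realfun ring lra zify.

Import Order.TTheory GRing.Theory Num.Theory.
Local Open Scope classical_set_scope.
Local Open Scope ring_scope.

(** * Independence: extension to generated sigma-algebras, and product formulas for integrals *)

Section independence.
Context {R : realType} {dT : measure_display} {T : measurableType dT}.
Variable P : probability T R.

(** As functions of [B], both sides are finite measures: [P] restricted to [E], and [P] scaled by
    [P E]. They agree on a pi-system containing the whole space, hence on the sigma-algebra it
    generates. *)
Lemma pi_lambda_indep (G : set (set T)) (E : set T) :
  setI_closed G -> G setT -> G `<=` measurable -> measurable E ->
  (forall B, G B -> P (B `&` E) = (P B * P E)%E) ->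
  forall B, <<s G >> B -> P (B `&` E) = (P B * P E)%E.
Proof.
move=> GI GT Gm mE GE.
have fE : (0 <= fine (P E))%R by rewrite fine_ge0.
have PEfin : P E = (fine (P E))%:E by rewrite fineK// fin_num_measure.
move=> B sB; rewrite PEfin muleC.
apply: (@g_sigma_algebra_measure_unique _ _ _ G Gm (fun=> setT)
    (fun=> GT) _ (mrestr P mE) (mscale (NngNum fE) P) GI _ _ B sB) => //.
- by rewrite bigcup_const.
- by move=> A GA; rewrite [LHS]GE// muleC [in LHS]PEfin.
- move=> _; apply: (@le_lt_trans _ _ (P setT)); last by rewrite probability_setT ltry.
  by apply: le_measure; rewrite ?inE//; exact: measurableI.
Qed.

Definition indep_events {I : finType} (A : I -> set T) : Prop :=
  P (\bigcap_(i in setT) A i) = (\big[*%E/1%E]_(i : I) P (A i))%E.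

(** The generators are replaced by their sigma-algebras one index at a time, through
    [pi_lambda_indep] with [E] the intersection of the other events. *)
Lemma indep_sigma {I : finType} (G : I -> set (set T)) :
  (forall i, setI_closed (G i)) -> (forall i, G i setT) ->
  (forall i, G i `<=` measurable) ->
  (forall A, (forall i, G i (A i)) -> indep_events A) ->
  forall A, (forall i, <<s G i >> (A i)) -> indep_events A.
Proof.
move=> GI GT Gm Gind A sA.
have sm i B : <<s G i >> B -> measurable B.
  by apply: smallest_sub; [exact: sigma_algebra_measurable|exact: Gm].
(* [s] lists the indices already allowed to range over the whole sigma-algebra. *)
suff H (s : seq I) : forall A, (forall i, if i \in s then <<s G i >> (A i)
    else G i (A i)) -> indep_events A.
  by apply: (H (index_enum I)) => i; rewrite mem_index_enum; exact: sA.
elim: s => [|k s IH] {sA}A sA; first by apply: Gind => i; have := sA i.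
have [ks|ks] := boolP (k \in s).
  by apply: IH => i; have := sA i; rewrite inE; case: eqVneq => [->|//]; rewrite ks.
pose upd B i := if i == k then B else A i.
have mA i : measurable (A i).
  have := sA i; case: ifP => _; [exact: sm|exact: Gm].
have updP B : G k B -> indep_events (upd B).
  move=> GB; apply: IH => i; rewrite /upd; case: eqVneq => [->|ik].
    by rewrite (negbTE ks).
  by have := sA i; rewrite inE (negbTE ik).
have capE B : \bigcap_(i in setT) upd B i =
    B `&` \bigcap_(i in setT) upd setT i.
  apply/seteqP; split => [x h|x [Bx h] i _].
    split; first by have := h k Logic.I; rewrite /upd eqxx.
    by move=> i _; have := h i Logic.I; rewrite /upd; case: eqP.
  by have := h i Logic.I; rewrite /upd; case: eqP.
have prodE B : (\big[*%E/1%E]_(i : I) P (upd B i))%E =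
    (P B * \big[*%E/1%E]_(i | i != k) P (A i))%E.
  rewrite (bigD1 k)//= {1}/upd eqxx; congr (_ * _)%E.
  by apply: eq_bigr => i ik; rewrite /upd (negbTE ik).
(* With [setT] at index [k], the product formula becomes that of the remaining events alone; this is
   where [G k setT] is used. *)
have := updP _ (GT k); rewrite /indep_events prodE probability_setT mul1e => PE.
have -> : A = upd (A k) by apply/funext => i; rewrite /upd; case: eqP => [->|].
rewrite /indep_events capE prodE -PE.
apply: (pi_lambda_indep (G k)) => //.
- apply: fin_bigcap_measurable => [|i _]; first exact: finite_finset.
  rewrite /upd; case: eqP => // _.
- by move=> B GB; rewrite -capE (updP _ GB) PE prodE.
- by have := sA k; rewrite inE eqxx.
Qed.

Import HBNNSimple.

(** The usual passage from indicators to simple functions of [V] by linearity, then to [V] by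
    monotone convergence, with [W] as a fixed weight. *)
Lemma integralM_of_indic (V W : T -> R) :
  measurable_fun setT V -> measurable_fun setT W ->
  (forall x, 0 <= V x) -> (forall x, 0 <= W x) ->
  (\int[P]_x (W x)%:E)%E \is a fin_num ->
  (forall B, measurable B -> (\int[P]_x (\1_(V @^-1` B) x * W x)%:E =
     P (V @^-1` B) * \int[P]_x (W x)%:E)%E) ->
  (\int[P]_x (V x * W x)%:E = \int[P]_x (V x)%:E * \int[P]_x (W x)%:E)%E.
Proof.
move=> mV mW V0 W0 Wfin VW.
have W0' : (0 <= \int[P]_x (W x)%:E)%E.
  by apply: integral_ge0 => x _; rewrite lee_fin.

(* The absolute value is approximated on the real line and then composed with [V], which is
   nonnegative. The level sets so obtained are preimages under [V], as the hypothesis on indicators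
   requires. *)
have mf : measurable_fun setT (fun x : R => (`|x|)%:E).
  by apply/measurable_EFinP; exact: normr_measurable.
pose g := nnsfun_approx measurableT mf.
have nd_g x n m : (n <= m)%N -> g n x <= g m x.
  by move=> nm; exact/lefP/nd_nnsfun_approx.
have mgV n : measurable_fun setT (fun x => g n (V x)) by exact: measurableT_comp.
have gcvg x : (g n (V x))%:E @[n --> \oo] --> (V x)%:E.
  rewrite -[in X in _ --> X](ger0_norm (V0 x)).
  exact: (@cvg_nnsfun_approx _ _ _ _ measurableT _ mf).
have step n : (\int[P]_x (g n (V x) * W x)%:E =
    \int[P]_x (g n (V x))%:E * \int[P]_x (W x)%:E)%E.
  have gE x : (g n (V x))%:E = (\sum_(r \in range (g n))
      (r * \1_(V @^-1` (g n @^-1` [set r])) x)%:E)%E.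
    by rewrite [in LHS]fimfunE -fsumEFin.
  have r0 r : r \in range (g n) -> 0 <= r.
    by rewrite inE => -[y _ <-].
  have mI r : measurable (V @^-1` (g n @^-1` [set r])).
    by rewrite -[X in measurable X]setTI; exact: mV.
  transitivity (\int[P]_x (\sum_(r \in range (g n))
      (r * (\1_(V @^-1` (g n @^-1` [set r])) x * W x))%:E))%E.
    apply: eq_integral => x _; rewrite EFinM gE ge0_mule_fsuml.
      by apply: eq_fsbigr => r _; rewrite -EFinM mulrA.
    move=> r; rewrite lee_fin.
    have [rr|nr] := boolP (r \in range (g n)).
      by rewrite mulr_ge0// r0.
    rewrite indicE (_ : (x \in _) = false) ?mulr0//.
    apply/negbTE; apply: contra nr; rewrite !inE/= => <-; by exists (V x).
  (* Outside the range of [g n] the level set is empty, so a negative [r] contributes zero. *)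
  have rneg r x : 0 <= r * \1_(V @^-1` (g n @^-1` [set r])) x.
    have [rr|nr] := boolP (r \in range (g n)); first by rewrite mulr_ge0// r0.
    rewrite indicE (_ : (x \in _) = false) ?mulr0//.
    apply/negbTE; apply: contra nr; rewrite !inE/= => <-; by exists (V x).
  under [X in _ = (X * _)%E]eq_integral do rewrite gE.
  rewrite !ge0_integral_fsum//=; last 4 first.
  - by move=> r; apply/measurable_EFinP/measurable_funM.
  - by move=> r x _; rewrite lee_fin.
  - move=> r; apply/measurable_EFinP/measurable_funM => //.
    exact: measurable_funM.
  - by move=> r x _; rewrite lee_fin mulrA mulr_ge0.
  rewrite ge0_mule_fsuml; last first.
    by move=> r; apply: integral_ge0 => x _; rewrite lee_fin.
  apply: eq_fsbigr => r rr.
  under eq_integral do rewrite EFinM.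
  rewrite ge0_integralZl//; last 3 first.
  - by apply/measurable_EFinP/measurable_funM.
  - by move=> x _; rewrite lee_fin mulr_ge0.
  - by rewrite lee_fin r0.
  rewrite VW//; under [X in _ = (X * _)%E]eq_integral do rewrite EFinM.
  rewrite ge0_integralZl//; last 2 first.
  - exact/measurable_EFinP.
  - by rewrite lee_fin r0.
  by rewrite integral_indic// setIT muleA.
have L : (\int[P]_x (g n (V x) * W x)%:E)%E @[n --> \oo] -->
    (\int[P]_x (V x * W x)%:E)%E.
  have -> : (\int[P]_x (V x * W x)%:E)%E =
      (\int[P]_x limn (fun n => (g n (V x) * W x)%:E))%E.
    apply: eq_integral => x _; apply/esym/cvg_lim => //.
    under eq_fun do rewrite EFinM; rewrite EFinM.
    by apply: cvgeMr => //; exact: gcvg.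
  apply: cvg_monotone_convergence => //.
  - by move=> n; apply/measurable_EFinP/measurable_funM.
  - by move=> n x _; rewrite lee_fin mulr_ge0.
  - by move=> x _ n m nm; rewrite lee_fin ler_wpM2r// nd_g.
have L2 : (\int[P]_x (g n (V x))%:E)%E @[n --> \oo] -->
    (\int[P]_x (V x)%:E)%E.
  have -> : (\int[P]_x (V x)%:E)%E =
      (\int[P]_x limn (fun n => (g n (V x))%:E))%E.
    by apply: eq_integral => x _; apply/esym/cvg_lim => //; exact: gcvg.
  apply: cvg_monotone_convergence => //.
  - by move=> n; apply/measurable_EFinP.
  - by move=> n x _; rewrite lee_fin.
  - by move=> x _ n m nm; rewrite lee_fin nd_g.
have L3 : (\int[P]_x (g n (V x))%:E * \int[P]_x (W x)%:E)%E @[n --> \oo] -->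
    (\int[P]_x (V x)%:E * \int[P]_x (W x)%:E)%E by exact: cvgeMr.
rewrite -(funext step) in L3; exact: (cvg_unique _ L L3).
Qed.

Definition indep_rvs {I : finType} (Y : I -> T -> R) : Prop :=
  forall B : I -> set R, (forall i, measurable (B i)) ->
    indep_events (fun i => Y i @^-1` B i).

Lemma indep_rvs_comp {I : finType} (Y : I -> T -> R) (f : I -> R -> R) :
  (forall i, measurable_fun setT (f i)) -> indep_rvs Y ->
  indep_rvs (fun i => f i \o Y i).
Proof.
move=> mf iY B mB; have := iY (fun i => f i @^-1` B i); apply=> i.
by rewrite -[X in measurable X]setTI; exact: mf.
Qed.

(** The induction mixes both kinds of factors: functions on the indices in [s], indicators of
    arbitrary events elsewhere. [integralM_of_indic] turns the indicator at a new index into a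
    function. *)
Lemma integral_prod_indep {I : finType} (V : I -> T -> R) :
  (forall i, measurable_fun setT (V i)) -> (forall i x, 0 <= V i x) ->
  (forall i, (\int[P]_x (V i x)%:E)%E \is a fin_num) -> indep_rvs V ->
  (\int[P]_x (\prod_i V i x)%:E = \big[*%E/1%E]_(i : I) \int[P]_x (V i x)%:E)%E.
Proof.
move=> mV V0 Vfin indV.
have mpre i (B : set R) : measurable B -> measurable (V i @^-1` B).
  by move=> mB; rewrite -[X in measurable X]setTI; exact: mV.
pose C (s : seq I) (B : I -> set R) :=
  \bigcap_(i in setT) (V i @^-1` (if i \in s then setT else B i)).
have mC s B : (forall i, measurable (B i)) -> measurable (C s B).
  move=> mB; apply: fin_bigcap_measurable => [|i _]; first exact: finite_finset.
  apply: mpre.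
  by case: ifP.
suff H (s : seq I) : uniq s -> forall B, (forall i, measurable (B i)) ->
    (\int[P]_x ((\prod_(i <- s) V i x) * \1_(C s B) x)%:E =
     (\big[*%E/1]_(i <- s) \int[P]_x (V i x)%:E) *
     \big[*%E/1]_(i | i \notin s) P (V i @^-1` B i))%E.
  have := H _ (index_enum_uniq I) (fun=> setT) (fun=> measurableT).
  rewrite [X in (_ * X)%E]big_pred0; last by move=> i; rewrite mem_index_enum.
  rewrite mule1 => <-; apply: eq_integral => x _.
  rewrite (_ : C _ _ = setT) ?indicT ?mulr1//.
  by apply/seteqP; split => // y _ i _; case: ifP.
elim: s => [_ B mB|k s IH /= /andP[ks us] B mB].
  transitivity (P (C [::] B)); last by rewrite big_nil mul1e; exact: indV.
  under eq_integral do rewrite big_nil mul1r.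
  by rewrite integral_indic ?setIT//; exact: mC.
pose upd D i := if i == k then D else B i.
have mupd D : measurable D -> forall i, measurable (upd D i).
  by move=> mD i; rewrite /upd; case: eqP.
(* [W] collects the factors at all indices but [k], where the constraint is relaxed to [setT]. *)
pose W x := (\prod_(i <- s) V i x) * \1_(C s (upd setT)) x.
have prodE D : (\big[*%E/1]_(i | i \notin s) P (V i @^-1` upd D i) =
    P (V k @^-1` D) * \big[*%E/1]_(i | i \notin k :: s) P (V i @^-1` B i))%E.
  rewrite (bigD1 k)//= {1}/upd eqxx; congr (_ * _)%E.
  apply: eq_big => [i|i /andP[_ ik]]; first by rewrite inE negb_or andbC.
  by rewrite /upd (negbTE ik).
have CE : C (k :: s) B = C s (upd setT).
  apply: eq_bigcapr => i _; congr (_ @^-1` _).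
  by rewrite inE /upd; case: eqP => //= _; case: ifP.
have mprod : measurable_fun setT (fun x => \prod_(i <- s) V i x).
  exact: measurable_prod.
have W0 x : 0 <= W x by rewrite mulr_ge0// prodr_ge0.
have WE : (\int[P]_x (W x)%:E = (\big[*%E/1]_(i <- s) \int[P]_x (V i x)%:E) *
     \big[*%E/1]_(i | i \notin k :: s) P (V i @^-1` B i))%E.
  by rewrite /W IH//; [rewrite prodE probability_setT mul1e|exact: mupd].
rewrite big_cons -muleA -WE -(integralM_of_indic (V k) W)//.
- by apply: eq_integral => x _; rewrite big_cons CE mulrA.
- by apply: measurable_funM => //; apply: measurable_indic; exact: (mC _ _ (mupd _ measurableT)).
- rewrite WE fin_numM//; elim/big_ind: _ => //; try by move=> *; rewrite fin_numM.
  by move=> i _; rewrite fin_num_measure//; exact: mpre.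
- move=> D mD.
  transitivity (\int[P]_x ((\prod_(i <- s) V i x) * \1_(C s (upd D)) x)%:E)%E.
    apply: eq_integral => x _; rewrite /W mulrCA; congr ((_ * _)%:E).
    rewrite -[LHS]/((\1_(V k @^-1` D) \* \1_(C s (upd setT))) x) -indicI.
    congr (\1_ _ x); apply/seteqP; split => [y [Dy h] i _|y h].
      have := h i Logic.I; rewrite /upd; case: ifP => // _.
      by case: eqP => // ->.
    split; first by have := h k Logic.I; rewrite /upd eqxx (negbTE ks).
    by move=> i _; have := h i Logic.I; rewrite /upd; case: ifP => // _; case: eqP.
  by rewrite IH//; [rewrite prodE muleCA WE|exact: mupd].
Qed.

(** The product formula with the constant factor 1 at every index other than [i] and [j]. *)
Lemma integralM_indep_ge0 {I : finType} (Y : I -> T -> R) (f g : R -> R) (i j : I) :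
  (forall k, measurable_fun setT (Y k)) -> indep_rvs Y -> i != j ->
  measurable_fun setT f -> measurable_fun setT g ->
  (forall x, 0 <= f x) -> (forall x, 0 <= g x) ->
  (\int[P]_x (f (Y i x))%:E)%E \is a fin_num ->
  (\int[P]_x (g (Y j x))%:E)%E \is a fin_num ->
  (\int[P]_x (f (Y i x) * g (Y j x))%:E =
   \int[P]_x (f (Y i x))%:E * \int[P]_x (g (Y j x))%:E)%E.
Proof.
move=> mY iY ij mf mg f0 g0 ffin gfin.
pose h k := if k == i then f else if k == j then g else cst 1.
have mh k : measurable_fun setT (h k) by rewrite /h; do 2?case: ifP.
have hi : h i = f by rewrite /h eqxx.
have hj : h j = g by rewrite /h eq_sym (negbTE ij) eqxx.
have ho k : k != i -> k != j -> h k = cst 1.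
  by move=> ki kj; rewrite /h (negbTE ki) (negbTE kj).
have := @integral_prod_indep I (fun k => h k \o Y k).
rewrite (bigD1 i)//= (bigD1 j)//= ?big1 ?mule1; last 2 first.
- by move=> k /andP[ki kj]; rewrite (ho k)//= integral_cst//= probability_setT mule1.
- by rewrite eq_sym.
rewrite hi hj => <-.
- apply: eq_integral => x _; rewrite (bigD1 i)//= (bigD1 j)//= ?big1 ?mulr1 ?hi ?hj//.
    by move=> k /andP[ki kj]; rewrite (ho k).
  by rewrite eq_sym.
- by move=> k; exact: measurableT_comp.
- by move=> k x; rewrite /h; do 2?case: ifP.
- move=> k; have [->|ki] := eqVneq k i; first by rewrite hi.
  have [->|kj] := eqVneq k j; first by rewrite hj.
  by rewrite (ho k)//= integral_cst//= probability_setT mule1.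
- exact: indep_rvs_comp.
Qed.

Lemma integrable_ge0 (f : T -> R) : measurable_fun setT f ->
  (forall x, 0 <= f x) -> (\int[P]_x (f x)%:E)%E \is a fin_num ->
  P.-integrable setT (EFin \o f).
Proof.
move=> mf f0 ffin; apply/integrableP; split; first exact/measurable_EFinP.
under eq_integral do rewrite /= ger0_norm//.
by rewrite ltey_eq ffin.
Qed.

(** Both variables are split into positive and negative parts, and the nonnegative case is applied
    to the four products. *)
Lemma RintegralM_indep {I : finType} (Y : I -> T -> R) (i j : I) :
  (forall k, P.-integrable setT (EFin \o Y k)) -> indep_rvs Y -> i != j ->
  \int[P]_x (Y i x * Y j x) = \int[P]_x Y i x * \int[P]_x Y j x.
Proof.
move=> intY iY ij.
have mY k : measurable_fun setT (Y k).
  by apply/measurable_EFinP; exact: measurable_int (intY k).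
pose f (y : R) := Num.max y 0; pose g (y : R) := Num.max (- y) 0.
have mf : measurable_fun setT f by exact: measurable_maxr.
have mg : measurable_fun setT g by apply: measurable_maxr => //; exact: oppr_measurable.
have f0 y : 0 <= f y by rewrite le_max lexx orbT.
have g0 y : 0 <= g y by rewrite le_max lexx orbT.
have fg y : y = f y - g y.
  rewrite /f /g; case: (leP 0 y) => y0; first by rewrite max_r ?subr0// oppr_le0.
  by rewrite max_l ?oppr_ge0 1?ltW// sub0r opprK.
have fint k : P.-integrable setT (EFin \o (f \o Y k)).
  apply: le_integrable (intY k) => //.
    by apply/measurable_EFinP; exact: measurableT_comp.
  move=> x _; rewrite /= lee_fin ger0_norm// ge_max normr_ge0 andbT.
  exact: ler_norm.
have gint k : P.-integrable setT (EFin \o (g \o Y k)).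
  apply: le_integrable (intY k) => //.
    by apply/measurable_EFinP; exact: measurableT_comp.
  move=> x _; rewrite /= lee_fin ger0_norm// ge_max normr_ge0 andbT.
  by rewrite -normrN; exact: ler_norm.
have pair (u v : R -> R) : measurable_fun setT u -> measurable_fun setT v ->
    (forall y, 0 <= u y) -> (forall y, 0 <= v y) ->
    P.-integrable setT (EFin \o (u \o Y i)) ->
    P.-integrable setT (EFin \o (v \o Y j)) ->
    P.-integrable setT (EFin \o (fun x => u (Y i x) * v (Y j x))) /\
    \int[P]_x (u (Y i x) * v (Y j x)) =
    \int[P]_x (u (Y i x)) * \int[P]_x (v (Y j x)).
  move=> mu mv u0 v0 /integrable_fin_num ufin /integrable_fin_num vfin.
  have E := integralM_indep_ge0 Y u v i j mY iY ij mu mv u0 v0 (ufin measurableT) (vfin measurableT).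
  move: ufin vfin => /(_ measurableT) ufin /(_ measurableT) vfin.
  split; last by rewrite /Rintegral E fineM.
  apply: integrable_ge0 => //.
  - by apply: measurable_funM; exact: measurableT_comp.
  - by move=> x; rewrite mulr_ge0.
  - by rewrite E fin_numM.
have [iff Eff] := pair f f mf mf f0 f0 (fint i) (fint j).
have [ifg Efg] := pair f g mf mg f0 g0 (fint i) (gint j).
have [igf Egf] := pair g f mg mf g0 f0 (gint i) (fint j).
have [igg Egg] := pair g g mg mg g0 g0 (gint i) (gint j).
have EY k : \int[P]_x Y k x = \int[P]_x f (Y k x) - \int[P]_x g (Y k x).
  rewrite -RintegralB//; [|exact: fint|exact: gint].
  by apply: eq_Rintegral => x _; exact: fg.
rewrite !EY mulrBl !mulrBr -Eff -Efg -Egf -Egg.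
rewrite -!RintegralB//.
- by apply: eq_Rintegral => x _; rewrite {1}(fg (Y i x)) {1}(fg (Y j x)) mulrBl !mulrBr.
- exact: (integrableB _ iff ifg).
- exact: (integrableB _ igf igg).
Qed.

End independence.

(** * Quadratic forms, the smallest eigenvalue, and rounding to a lattice *)

Section quadratic_forms.
Context {R : realType} {m : nat}.
Implicit Types (M N : 'M[R]_m) (v w : 'rV[R]_m).

Definition qform M v : R := (v *m M *m v^T) 0 0.
Definition sqnorm v : R := \sum_j v 0 j ^+ 2.

Lemma qformE M v : qform M v = \sum_j \sum_k v 0 j * M j k * v 0 k.
Proof.
rewrite /qform mxE exchange_big/=; apply: eq_bigr => k _.
by rewrite !mxE mulr_suml.
Qed.

Lemma qform_scalar (c : R) v : qform c%:M v = c * sqnorm v.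
Proof.
rewrite /qform mul_mx_scalar -scalemxAl mxE mxE; congr (_ * _).
by apply: eq_bigr => j _; rewrite mxE expr2.
Qed.

Lemma sqnorm_ge0 v : 0 <= sqnorm v.
Proof. by apply: sumr_ge0 => j _; rewrite sqr_ge0. Qed.

Lemma sqnorm_eq0 v : sqnorm v = 0 -> v = 0.
Proof.
move=> /eqP; rewrite psumr_eq0; last by move=> j _; rewrite sqr_ge0.
move=> /allP v0; apply/rowP => j; rewrite mxE.
by have := v0 j (mem_index_enum j); rewrite /= sqrf_eq0 => /eqP.
Qed.

Lemma qformB M N v : qform (M - N) v = qform M v - qform N v.
Proof. by rewrite /qform mulmxBr mulmxBl !mxE. Qed.

Lemma qformZ M (a : R) v : qform M (a *: v) = a ^+ 2 * qform M v.
Proof.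
by rewrite /qform linearZ/= -!scalemxAl -scalemxAr !mxE mulrA -expr2.
Qed.

Lemma sqnormZ (a : R) v : sqnorm (a *: v) = a ^+ 2 * sqnorm v.
Proof.
by rewrite /sqnorm mulr_sumr; apply: eq_bigr => j _; rewrite mxE exprMn.
Qed.

(** A crude bound from [|v_j v_k| <= |v|^2]; its uses ask only for some finite constant. *)
Lemma qform_bound M v : `|qform M v| <= (\sum_j \sum_k `|M j k|) * sqnorm v.
Proof.
rewrite qformE (le_trans (ler_norm_sum _ _ _))// mulr_suml.
apply: ler_sum => j _; rewrite (le_trans (ler_norm_sum _ _ _))// mulr_suml.
apply: ler_sum => k _; rewrite !normrM mulrAC mulrC.
apply: ler_wpM2l => //.
have le1 i : `|v 0 i| ^+ 2 <= sqnorm v.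
  rewrite real_normK ?num_real// /sqnorm (bigD1 i)//= lerDl.
  by apply: sumr_ge0 => l _; rewrite sqr_ge0.
have := le1 j; have := le1 k; have := sqr_ge0 (`|v 0 j| - `|v 0 k|).
by nra.
Qed.

Lemma qform_addZ M v w (s : R) :
  qform M (v + s *: w) = qform M v +
    s * ((v *m M *m w^T) 0 0 + (w *m M *m v^T) 0 0) + s ^+ 2 * qform M w.
Proof.
have addE (A B : 'M[R]_1) : (A + B) 0 0 = A 0 0 + B 0 0 by rewrite mxE.
have scaleE (c : R) (A : 'M[R]_1) : (c *: A) 0 0 = c * A 0 0 by rewrite mxE.
rewrite /qform linearD/= linearZ/= mulmxDl mulmxDr !mulmxDl -!scalemxAl.
by rewrite -!scalemxAr !(addE, scaleE); ring.
Qed.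

(* Evaluating the form at [v - s *: (v *m invmx N)] for small [s] gives the
   gap without any compactness argument. *)
Lemma qform_unit_gap N : N^T = N -> (forall v, 0 <= qform N v) ->
  N \in unitmx -> exists2 e, 0 < e & forall v, e * sqnorm v <= qform N v.
Proof.
move=> symN psdN uN.
set K := \sum_j \sum_k `|invmx N j k| + 1.
have K0 : 0 < K.
  by rewrite ltr_wpDl// sumr_ge0// => j _; apply: sumr_ge0.
exists K^-1; first by rewrite invr_gt0.
move=> v; set w := v *m invmx N.
have symI : (invmx N)^T = invmx N by rewrite trmx_inv symN.
have wN : w *m N = v by rewrite /w -mulmxA mulVmx// mulmx1.
have nE : (v *m v^T) 0 0 = sqnorm v.
  by have := qform_scalar 1 v; rewrite /qform mulmx1 mul1r.
have b1 : (v *m N *m w^T) 0 0 = sqnorm v.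
  by rewrite /w trmx_mul symI mulmxA -(mulmxA v) mulmxV// mulmx1.
have b2 : (w *m N *m v^T) 0 0 = sqnorm v by rewrite wN.
have b3 : qform N w = qform (invmx N) v.
  by rewrite /qform wN /w trmx_mul symI mulmxA.
have := psdN (v + (- K^-1) *: w); rewrite qform_addZ b1 b2 b3.
have le3 : qform (invmx N) v <= K * sqnorm v.
  apply: le_trans (ler_norm _) _; apply: le_trans (qform_bound _ _) _.
  by rewrite ler_wpM2r ?sqnorm_ge0// lerDl.
have : K^-1 ^+ 2 * qform (invmx N) v <= K^-1 * sqnorm v.
  rewrite expr2 -mulrA; apply: ler_wpM2l; first by rewrite invr_ge0 ltW.
  by rewrite mulrC ler_pdivrMr// mulrC.
by rewrite sqrrN; lra.
Qed.

(** Let [a] be the largest constant with [a |v|^2 <= qform M v] for all [v]. Were [a] not an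
    eigenvalue, [M - a] would be invertible and positive semidefinite, and [qform_unit_gap] would
    allow a larger constant. *)
Lemma min_eigenvalue M : (0 < m)%N -> M^T = M ->
  exists2 a, eigenvalue M a & forall v, a * sqnorm v <= qform M v.
Proof.
move=> m0 symM.
pose S := [set c : R | forall v, c * sqnorm v <= qform M v].
set K := \sum_j \sum_k `|M j k|.
have S0 : S !=set0.
  exists (- K) => v; rewrite mulNr lerNl; apply: le_trans (qform_bound M v).
  by rewrite -normrN; exact: ler_norm.
pose d : 'rV[R]_m := delta_mx 0 (Ordinal m0).
have d1 : sqnorm d = 1.
  rewrite /sqnorm (bigD1 (Ordinal m0))//= big1 ?addr0; last first.
    by move=> i /negbTE i0; rewrite !mxE i0 expr0n.
  by rewrite !mxE !eqxx expr1n.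
have Sub : has_ubound S.
  by exists (qform M d) => c /(_ d); rewrite d1 mulr1.
set a := sup S.
have Sa : S a.
  move=> v; have := sqnorm_ge0 v; rewrite le_eqVlt => /predU1P[/esym/sqnorm_eq0 ->|v0].
    rewrite /qform /sqnorm !mul0mx mxE big1 ?mulr0// => j _.
    by rewrite mxE expr0n.
  rewrite -ler_pdivlMr//; apply: ge_sup => // c /(_ v).
  by rewrite ler_pdivlMr.
exists a => //; rewrite /eigenvalue /eigenspace kermx_eq0 row_free_unit.
apply/negP => uN.
have [||e e0 gap] := qform_unit_gap (M - a%:M) _ _ uN.
- by rewrite linearB/= symM tr_scalar_mx.
- by move=> v; rewrite qformB qform_scalar subr_ge0.
have : S (a + e).
  by move=> v; have := gap v; rewrite qformB qform_scalar mulrDl; lra.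
move=> /(ub_le_sup Sub); rewrite -/a; lra.
Qed.

(** The eigenvalue from [min_eigenvalue] is a lower bound of the Rayleigh quotient, hence of all
    eigenvalues. So the set defining [lambda_min] is nonempty and bounded below, and its [inf] is
    not a default value. *)
Lemma le_lambda_min M (c : R) : (0 < m)%N -> M^T = M ->
  c <= lambda_min M <-> forall v, c * sqnorm v <= qform M v.
Proof.
move=> m0 symM; have [a ea aM] := min_eigenvalue M m0 symM.
have lbP b x : eigenvalue M b -> (forall v, x * sqnorm v <= qform M v) -> x <= b.
  move=> /eigenvalueP[v vM v0] /(_ v).
  have -> : qform M v = b * sqnorm v.
    by rewrite -qform_scalar /qform vM mul_mx_scalar.
  rewrite ler_pM2r// lt_neqAle sqnorm_ge0 andbT eq_sym.
  by apply: contra v0 => /eqP/sqnorm_eq0 ->.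
split=> [cl v|H].
  apply: le_trans (aM v); apply: ler_wpM2r; first exact: sqnorm_ge0.
  apply: le_trans cl _; apply: ge_inf => //.
  by exists a => b eb; exact: lbP.
by apply: lb_le_inf; [exists a|move=> b eb; exact: lbP].
Qed.

(* One of the two lattice neighbours does at least as well as rounding at
   random with mean [v 0 k], whose variance is at most [h ^+ 2 / 4]. *)
Lemma round_coord M (h : R) v (k : 'I_m) : 0 < h -> exists z : int,
  `|h * z%:~R - v 0 k| <= h /\
  qform M (v + (h * z%:~R - v 0 k) *: delta_mx 0 k) <=
    qform M v + h ^+ 2 / 4 * `|M k k|.
Proof.
move=> h0; set x := v 0 k; set z := Num.floor (x / h).
pose d : 'rV[R]_m := delta_mx 0 k.
set s := h * z%:~R - x.
have s0 : s <= 0.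
  by rewrite subr_le0 mulrC -ler_pdivlMr// floor_le_tmp.
have sh : 0 < s + h.
  have : x / h < (z + 1)%:~R by rewrite floorD1_gt.
  by rewrite ltr_pdivrMr// intrD /s; lra.
have dM : qform M d = M k k.
  rewrite qformE (bigD1 k)//= [X in _ + X]big1 ?addr0; last first.
    move=> i /negbTE ik; apply: big1 => j _.
    by rewrite !mxE ik /= !mul0r.
  rewrite (bigD1 k)//= big1 ?addr0; last first.
    by move=> i /negbTE ik; rewrite !mxE ik /= mulr0.
  by rewrite !mxE !eqxx mul1r mulr1.
set B := h ^+ 2 / 4 * `|M k k|.
set L := (v *m M *m d^T) 0 0 + (d *m M *m v^T) 0 0.
have qE t : qform M (v + t *: d) = qform M v + t * L + t ^+ 2 * M k k.
  by rewrite qform_addZ dM.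
have sE : h * (z + 1)%:~R - x = s + h by rewrite intrD /s; lra.
have [le1|gt1] := leP (qform M (v + s *: d)) (qform M v + B).
  by exists z; split => //; rewrite -/s ler0_norm//; lra.
exists (z + 1); rewrite sE; split; first by rewrite gtr0_norm//; lra.
rewrite leNgt; apply/negP => gt2.
move: gt1 gt2; rewrite !qE => gt1 gt2.
have g1 : B < s * L + s ^+ 2 * M k k by lra.
have g2 : B < (s + h) * L + (s + h) ^+ 2 * M k k by lra.
(* Adding the two inequalities with weights [s + h] and [- s], whose sum is [h], cancels the linear
   term [L]. *)
have hB : h * B < h * (- (s * (s + h)) * M k k).
  have := ltr_pM2l sh B (s * L + s ^+ 2 * M k k); rewrite g1.
  have : (- s) * B <= (- s) * ((s + h) * L + (s + h) ^+ 2 * M k k).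
    by apply: ler_wpM2l; [rewrite oppr_ge0|exact: ltW].
  by move=> a1 a2; nra.
move: hB; rewrite ltr_pM2l// ltNge => /negP; apply.
have ss0 : 0 <= - (s * (s + h)) by rewrite -mulNr mulr_ge0 ?oppr_ge0// ltW.
apply: (@le_trans _ _ (- (s * (s + h)) * `|M k k|)).
  by apply: ler_wpM2l => //; exact: ler_norm.
(* The variance bound [- s (s + h) <= h^2 / 4] amounts to [(2 s + h)^2 >= 0]. *)
by apply: ler_wpM2r => //; have := sqr_ge0 (2 * s + h); nra.
Qed.

Definition lattice_row (h : R) (n : 'I_m -> int) : 'rV[R]_m :=
  \row_j (h * (n j)%:~R).

(** Coordinates are rounded one after the other by [round_coord]; the vector [u] is on the lattice
    in the treated coordinates and still equals [v] in the others. The absolute values allow forms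
    that are not positive. *)
Lemma round_lattice M (h : R) v : 0 < h -> exists n : {ffun 'I_m -> int},
  (forall j, `|h * (n j)%:~R - v 0 j| <= h) /\
  qform M (lattice_row h n) <= qform M v + h ^+ 2 / 4 * \sum_j `|M j j|.
Proof.
move=> h0.
suff [n [u [H1 H2 H3 H4]]] : exists (n : {ffun 'I_m -> int}) (u : 'rV[R]_m),
    [/\ forall j, j \in index_enum 'I_m -> `|h * (n j)%:~R - v 0 j| <= h,
        forall j, j \in index_enum 'I_m -> u 0 j = h * (n j)%:~R,
        forall j, j \notin index_enum 'I_m -> u 0 j = v 0 j &
        qform M u <= qform M v +
          h ^+ 2 / 4 * \sum_(j <- index_enum 'I_m) `|M j j|].
  exists n; split; first by move=> j; apply: H1; rewrite mem_index_enum.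
  rewrite (_ : lattice_row h n = u)//; apply/rowP => j.
  by rewrite mxE H2// mem_index_enum.
elim: (index_enum _) (index_enum_uniq 'I_m) => [_|k s IH /= /andP[ks us]].
  exists [ffun=> 0], v; split=> //.
  by rewrite big_nil mulr0 addr0.
have [n [u [H1 H2 H3 H4]]] := IH us.
have [z [z1 z2]] := round_coord M h u k h0.
exists [ffun j => if j == k then z else n j].
exists (u + (h * z%:~R - u 0 k) *: delta_mx 0 k); split.
- move=> j; rewrite inE ffunE; case: eqVneq => [-> _|_ /= js]; last exact: H1.
  by rewrite -(H3 k ks).
- move=> j; rewrite inE ffunE !mxE; case: eqVneq => [-> _|_ /= js].
    by rewrite eqxx /= mulr1 addrC subrK.
  by rewrite mulr0 addr0 H2.
- move=> j; rewrite inE negb_or => /andP[/negbTE jk js].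
  by rewrite !mxE jk mulr0 addr0 H3.
- by rewrite big_cons mulrDr; lra.
Qed.

(** This reduces the eigenvalue bound to countably many conditions, for measurability. Rounding
    [t v] to an integer point costs a constant [K] independent of [t], while the form grows like
    [t^2]; a negative value at [v] would thus show up at an integer point. *)
Lemma le_lambda_min_int M (c : R) : (0 < m)%N -> M^T = M ->
  c <= lambda_min M <-> forall n : {ffun 'I_m -> int},
    c * sqnorm (lattice_row 1 n) <= qform M (lattice_row 1 n).
Proof.
move=> m0 symM; rewrite le_lambda_min//; split=> [H n//|H v].
pose N := M - c%:M; set K := 1 ^+ 2 / 4 * \sum_j `|N j j|.
have NE u : qform N u = qform M u - c * sqnorm u by rewrite qformB qform_scalar.
suff : 0 <= qform N v by rewrite NE subr_ge0.
have K0 : 0 <= K by rewrite mulr_ge0// sumr_ge0.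
have key (t : nat) : 0 <= t%:R ^+ 2 * qform N v + K.
  have [n [_]] := round_lattice N 1 (t%:R *: v) ltr01.
  rewrite qformZ -/K; apply: le_trans.
  by rewrite NE subr_ge0.
rewrite leNgt; apply/negP => q0.
pose t := Num.bound (K / - qform N v).
have : K / - qform N v < t%:R.
  by apply: archi_boundP; rewrite divr_ge0// oppr_ge0 ltW.
rewrite ltr_pdivrMr ?oppr_gt0// => Kt.
(* The successor is taken because [t <= (t + 1)^2] holds for every natural [t], so that [(t + 1)^2]
   also exceeds the threshold. *)
have := key t.+1; rewrite leNgt => /negP; apply.
have t0 : (0 : R) <= t%:R by [].
rewrite -natr1; have : t%:R <= (t%:R + 1) ^+ 2 :> R by nra.
by nra.
Qed.

End quadratic_forms.

(** * Counting integer points in a ball *)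

Section lattice_count.
Context {R : realType}.

(** Ordinals stand for the integers from [-B] to [B], so that a box of integer points is a finite
    type. *)
Definition centered_int (B : nat) (i : 'I_(2 * B).+1) : int := i%:Z - B%:Z.

Lemma centered_int_inord (B : nat) (z : int) : - B%:Z <= z <= B%:Z ->
  centered_int B (inord (absz (z + B%:Z))) = z.
Proof.
move=> zB; have zB' : (absz (z + B%:Z)%R < (2 * B).+1)%N by lia.
by rewrite /centered_int inordK//; lia.
Qed.

(** A two-sided geometric series, built by adding both end terms; what matters is the bound 3,
    uniform in [B]. *)
Lemma sum_half_pow (B : nat) :
  \sum_(i < (2 * B).+1) (2^-1 : R) ^+ `|centered_int B i|%N = 3 - 2 * 2^-1 ^+ B.
Proof.
elim: B => [|B IH].
  by rewrite big_ord1 /centered_int subrr absz0 !expr0; lra.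
have E : (2 * B.+1).+1 = (2 * B).+3 by rewrite mulnS.
transitivity (\sum_(i < (2 * B).+3) (2^-1 : R) ^+ `|(i : nat)%:Z - B.+1%:Z|%N).
  by rewrite -!(big_mkord xpredT (fun i => 2^-1 ^+ `|i%:Z - B.+1%:Z|%N)) E.
rewrite big_ord_recl big_ord_recr/=.
transitivity ((2^-1 : R) ^+ B.+1 + (\sum_(i < (2 * B).+1)
    (2^-1 : R) ^+ `|centered_int B i|%N + 2^-1 ^+ B.+1)).
  congr (_ + _); first by congr (_ ^+ _); lia.
  congr (_ + _); last by congr (_ ^+ _); rewrite /bump/=; lia.
  by apply: eq_bigr => i _; congr (_ ^+ _); rewrite /bump/= /centered_int; lia.
rewrite IH.
by rewrite exprS; lra.
Qed.

Lemma expR_ge_pow2 (k : nat) : (2 : R) ^+ k <= expR k%:R.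
Proof.
rewrite -(mulr1 k%:R) expRM_natl lerXn2r ?nnegrE ?expR_ge0//.
by have := expR_ge1Dx (1 : R); lra.
Qed.

(** Weight a point [z] by [2^(-|z|_1)]: the total mass is at most [3^m]. Integers satisfy
    [|z_j| <= z_j^2], so a counted point has [|z|_1 <= L] and weight at least [exp(-L)]. The bound
    does not depend on the box size [B]. *)
Lemma lattice_count (m B : nat) (L : R) :
  (\sum_(f : {ffun 'I_m -> 'I_(2 * B).+1} |
     \sum_j ((centered_int B (f j))%:~R : R) ^+ 2 <= L) (1 : R))
    <= expR L * 3 ^+ m.
Proof.
pose w (f : {ffun 'I_m -> 'I_(2 * B).+1}) : R :=
  \prod_j 2^-1 ^+ `|centered_int B (f j)|%N.
have w0 f : 0 <= w f by apply: prodr_ge0 => j _; apply: exprn_ge0.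
have wE : \sum_f w f <= 3 ^+ m.
  rewrite -(bigA_distr_bigA (fun (_ : 'I_m) (i : 'I_(2 * B).+1) =>
    (2^-1 : R) ^+ `|centered_int B i|%N))/=.
  rewrite prodr_const card_ord sum_half_pow lerXn2r ?nnegrE//.
    by rewrite -sum_half_pow; apply: sumr_ge0 => i _; apply: exprn_ge0.
  by rewrite lerBlDr lerDl mulr_ge0// exprn_ge0.
apply: (@le_trans _ _ (\sum_f expR L * w f)); last first.
  by rewrite -mulr_sumr ler_wpM2l// expR_ge0.
rewrite big_mkcond/=; apply: ler_sum => f _.
case: ifP => [fL|_]; last by rewrite mulr_ge0// expR_ge0.
set S := (\sum_j `|centered_int B (f j)|)%N.
have wfE : w f = (2 ^+ S)^-1.
  rewrite /w -exprVn -expr_sum; congr (_ ^+ _).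
rewrite wfE -ler_pdivrMr ?invr_gt0 ?exprn_gt0// invrK mul1r.
apply: le_trans (expR_ge_pow2 S) _; rewrite ler_expR; apply: le_trans fL.
rewrite /S natr_sum; apply: ler_sum => j _.
set z := centered_int B (f j).
have -> : (z%:~R : R) ^+ 2 = ((`|z| ^ 2)%N%:R : R).
  by rewrite natrX; case: z => k; rewrite ?absz_nat ?NegzE ?mulrNz ?sqrrN.
rewrite ler_nat; nia.
Qed.

End lattice_count.

(** * Moments and Laplace transform of the square of one sub-Gaussian variable *)

Section subgaussian.
Context {R : realType} {dT : measure_display} {T : measurableType dT}.
Variable P : probability T R.
Implicit Types (W : T -> R) (v t rho : R).

Lemma integrable_le_fin (f : T -> R) (c : R) :
  measurable_fun setT f -> (forall x, 0 <= f x) ->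
  (\int[P]_x (f x)%:E <= c%:E)%E ->
  P.-integrable setT (EFin \o f) /\ \int[P]_x f x <= c.
Proof.
move=> mf f0 fc.
have ffin : (\int[P]_x (f x)%:E)%E \is a fin_num.
  rewrite ge0_fin_numE; first exact: le_lt_trans fc (ltry _).
  by apply: integral_ge0 => x _; rewrite lee_fin.
split; first exact: integrable_ge0.
by rewrite -lee_fin /Rintegral fineK.
Qed.

Lemma integrable_sum_EFin {I : Type} (s : seq I) (f : I -> T -> R) :
  (forall i, P.-integrable setT (EFin \o f i)) ->
  P.-integrable setT (EFin \o (fun x => \sum_(i <- s) f i x)).
Proof.
move=> intf.
have := @integrable_sum _ _ _ P _ measurableT I s xpredT (fun i => EFin \o f i).
move=> /(_ (fun i _ => intf i)); apply: eq_integrable => // x _ /=.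
by rewrite sumEFin.
Qed.

Lemma Rintegral_sum {I : Type} (s : seq I) (f : I -> T -> R) :
  (forall i, P.-integrable setT (EFin \o f i)) ->
  \int[P]_x (\sum_(i <- s) f i x) = \sum_(i <- s) \int[P]_x f i x.
Proof.
move=> intf; elim: s => [|i s IH].
  under eq_Rintegral do rewrite big_nil.
  by rewrite big_nil Rintegral_cst// mul0r.
under eq_Rintegral do rewrite big_cons.
rewrite RintegralD//; first by rewrite big_cons IH.
exact: (integrable_sum_EFin s f).
Qed.

Lemma Rintegral_prob_cst (c : R) : \int[P]_x c = c.
Proof. by rewrite Rintegral_cst//= probability_setT mulr1. Qed.

Lemma integrable_cst (c : R) : P.-integrable setT (EFin \o cst c).
Proof. exact: finite_measure_integrable_cst. Qed.

(** The second moment is a real parameter [v], which makes it finite and lets that of a linear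
    combination be given by a formula. *)
Definition subgaussian_mom rho W v : Prop :=
  [/\ measurable_fun setT W,
      (\int[P]_x (W x ^+ 2)%:E)%E = v%:E &
      forall t, (\int[P]_x (expR (t * W x))%:E <=
        (expR (t ^+ 2 * rho ^+ 2 * v / 2))%:E)%E].

Section one_variable.
Variables (rho : R) (W : T -> R) (v : R).
Hypotheses (rho0 : 0 < rho) (sgW : subgaussian_mom rho W v).

Let mW : measurable_fun setT W. Proof. by case: sgW. Qed.

Lemma subgaussian_mom_ge0 : 0 <= v.
Proof.
case: sgW => _ W2 _; rewrite -lee_fin -W2.
by apply: integral_ge0 => x _; rewrite lee_fin sqr_ge0.
Qed.

Lemma subgaussian_sq_integrable :
  P.-integrable setT (EFin \o (fun x => W x ^+ 2)) /\ \int[P]_x (W x ^+ 2) = v.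
Proof.
case: sgW => _ W2 _; split; last by rewrite /Rintegral W2.
apply: integrable_ge0; rewrite ?W2//; first exact: measurable_funX.
by move=> x; rewrite sqr_ge0.
Qed.

Lemma subgaussian_integrable : P.-integrable setT (EFin \o W).
Proof.
have [i2 _] := subgaussian_sq_integrable.
have i12 : P.-integrable setT (EFin \o (fun x => 1 + W x ^+ 2)).
  exact: (integrableD measurableT (integrable_cst 1) i2).
apply: le_integrable i12 => //; first exact/measurable_EFinP.
move=> x _; rewrite /= lee_fin [leRHS]ger0_norm ?addr_ge0 ?sqr_ge0//.
by rewrite -(real_normK (num_real (W x))); have := sqr_ge0 (`|W x| - 1); nra.
Qed.

Lemma subgaussian_mgf t :
  P.-integrable setT (EFin \o (fun x => expR (t * W x))) /\
  \int[P]_x expR (t * W x) <= expR (t ^+ 2 * rho ^+ 2 * v / 2).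
Proof.
case: sgW => _ _ mgf; apply: integrable_le_fin => //.
by apply: measurableT_comp => //; exact: measurable_funM.
Qed.

Lemma expR_le_inv (y : R) : y < 1 -> expR y <= (1 - y)^-1.
Proof.
move=> y1; rewrite -[expR y]invrK -expRN lef_pV2 ?posrE ?expR_gt0 ?subr_gt0//.
exact: expR_ge1Dx.
Qed.

(* [1 + t E W <= E exp(t W) <= exp(a t^2)] for all small [t]. *)
Lemma subgaussian_mean0 : \int[P]_x W x = 0.
Proof.
set mu := \int[P]_x W x.
have iW := subgaussian_integrable.
set a := rho ^+ 2 * v / 2.
have a0 : 0 <= a by rewrite /a divr_ge0// mulr_ge0 ?sqr_ge0// subgaussian_mom_ge0.
have key t : 1 + t * mu <= expR (a * t ^+ 2).
  have [ie le] := subgaussian_mgf t.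
  have -> : a * t ^+ 2 = t ^+ 2 * rho ^+ 2 * v / 2 by rewrite /a; lra.
  apply: le_trans le.
  have itW : P.-integrable setT (EFin \o (fun x => t * W x)).
    exact: (integrableZl measurableT t iW).
  rewrite -[X in X + _]Rintegral_prob_cst -RintegralZl// -RintegralD//; last first.
    exact: integrable_cst.
  apply: le_Rintegral => //; last by move=> x _; exact: expR_ge1Dx.
  exact: (integrableD measurableT (integrable_cst 1) itW).
apply/eqP/negPn/negP => mu0.
have m2 : 0 < mu ^+ 2 by rewrite exprn_even_gt0.
(* The inequality is tested at [t = mu r]. The summand [2 a mu^2] keeps the exponent [y = a t^2] at
   most [1/2], where [exp y <= 1 + 2 y]; the summand [4 a] makes [2 y] at most half of [t mu], a
   contradiction. *)
pose r := (1 + 4 * a + 2 * a * mu ^+ 2)^-1.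
have am : 0 <= a * mu ^+ 2 by rewrite mulr_ge0// ltW.
have D0 : 0 < 1 + 4 * a + 2 * a * mu ^+ 2.
  by have := am; nra.
have r0 : 0 < r by rewrite invr_gt0.
have rD : r * (1 + 4 * a + 2 * a * mu ^+ 2) = 1 by rewrite mulVf// gt_eqF.
have r1 : r <= 1 by rewrite -rD; nra.
have ar : 4 * (a * r) <= 1 by nra.
have amr : 2 * (a * mu ^+ 2 * r) <= 1 by nra.
set y := a * (mu * r) ^+ 2.
have yE : y = a * mu ^+ 2 * r * r by rewrite /y; ring.
have y0 : 0 <= y by rewrite yE (mulr_ge0 (mulr_ge0 am (ltW r0)) (ltW r0)).
have y2 : 2 * y <= 1 by rewrite yE; nra.
have := key (mu * r); rewrite -/y => k1.
have k2 : expR y <= 1 + 2 * y.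
  apply: le_trans (expR_le_inv y _) _; first by lra.
  rewrite -[leLHS]mul1r ler_pdivrMr; last by lra.
  nra.
have : mu * r * mu <= 2 * y by lra.
have -> : mu * r * mu = mu ^+ 2 * r by ring.
have -> : 2 * y = (2 * (a * r)) * (mu ^+ 2 * r) by rewrite yE; ring.
have : 0 < mu ^+ 2 * r by rewrite mulr_gt0.
nra.
Qed.

(** The fourth power of [x / 4 <= exp(x / 4)] for [x >= 0]; [256 = 4^4]. *)
Lemma pow4_le_expR (x : R) : x ^+ 4 <= 256 * (expR x + expR (- x)).
Proof.
wlog x0 : x / 0 <= x => [H|].
  have [/H//|x0] := leP 0 x.
  have := H (- x); rewrite opprK addrC.
  by rewrite (_ : (- x) ^+ 4 = x ^+ 4); [apply; rewrite oppr_ge0 ltW|ring].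
apply: (@le_trans _ _ (256 * expR x)); last first.
  by have := expR_ge0 (- x); lra.
have -> : expR x = expR (x / 4) ^+ 4.
  by rewrite -expRM_natl; congr expR; lra.
have -> : x ^+ 4 = 256 * (x / 4) ^+ 4 by field.
apply: ler_wpM2l; first by rewrite ler0n.
rewrite lerXn2r ?nnegrE ?expR_ge0//; first by lra.
by have := expR_ge1Dx (x / 4); lra.
Qed.

(** Apply [pow4_le_expR] to [t W] with [t^2 rho^2 v = 2], so that both exponential moments are at
    most [e <= 4]. Then [256 (4 + 4) / t^4 = 512 rho^4 v^2]; choosing [t] needs [v > 0]. *)
Lemma subgaussian_fourth : 0 < v ->
  P.-integrable setT (EFin \o (fun x => W x ^+ 4)) /\
  \int[P]_x (W x ^+ 4) <= 512 * rho ^+ 4 * v ^+ 2.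
Proof.
move=> v0; have rv0 : 0 < rho ^+ 2 * v by rewrite mulr_gt0// exprn_gt0.
pose t := Num.sqrt (2 / (rho ^+ 2 * v)).
have t2 : t ^+ 2 = 2 / (rho ^+ 2 * v) by rewrite sqr_sqrtr// divr_ge0// ltW.
have t4 : t ^+ 4 = 4 / (rho ^+ 4 * v ^+ 2).
  rewrite (_ : t ^+ 4 = t ^+ 2 ^+ 2); last by ring.
  rewrite t2; field.
  by rewrite !gt_eqF.
have t40 : 0 < t ^+ 4 by rewrite t4 divr_gt0// mulr_gt0// exprn_gt0.
have e4 : expR 1 <= 4 :> R.
  have -> : expR 1 = expR (2^-1) ^+ 2 :> R.
    by rewrite -expRM_natl; congr expR; lra.
  have h : expR (2^-1) <= 2 :> R.
    apply: le_trans (expR_le_inv _ _) _; first by lra.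
    by rewrite (_ : 1 - 2^-1 = 2^-1 :> R) ?invrK//; lra.
  by have := expR_ge0 (2^-1 : R); nra.
have [i1 l1] := subgaussian_mgf t; have [i2 l2] := subgaussian_mgf (- t).
have b : t ^+ 2 * rho ^+ 2 * v / 2 = 1.
  by rewrite t2; field; rewrite !gt_eqF.
rewrite sqrrN in l2; rewrite b in l1 l2.
have i3 : P.-integrable setT
    (EFin \o (fun x => expR (t * W x) + expR (- t * W x))).
  exact: (integrableD measurableT i1 i2).
set c := 256 / t ^+ 4.
have c0 : 0 < c by apply: divr_gt0; [rewrite ltr0n|exact: t40].
have i4 : P.-integrable setT
    (EFin \o (fun x => c * (expR (t * W x) + expR (- t * W x)))).
  exact: (integrableZl measurableT c i3).
have le4 x : W x ^+ 4 <= c * (expR (t * W x) + expR (- t * W x)).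
  rewrite /c mulrAC ler_pdivlMr// mulrC -exprMn mulNr.
  exact: pow4_le_expR.
have W40 x : 0 <= W x ^+ 4 by rewrite exprn_even_ge0.
have iW4 : P.-integrable setT (EFin \o (fun x => W x ^+ 4)).
  apply: le_integrable i4 => //.
    by apply/measurable_EFinP; exact: measurable_funX.
  move=> x _; rewrite /= lee_fin !ger0_norm//.
  exact: le_trans (W40 x) (le4 x).
split=> //; apply: (@le_trans _ _ (c * (4 + 4))).
  apply: (@le_trans _ _
    (\int[P]_x (c * (expR (t * W x) + expR (- t * W x))))).
    exact: le_Rintegral.
  rewrite RintegralZl// ler_pM2l// RintegralD//.
  by apply: lerD; [exact: le_trans l1 e4|exact: le_trans l2 e4].
rewrite /c t4 le_eqVlt; apply/orP; left; apply/eqP; field.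
by rewrite !gt_eqF.
Qed.

(** Integrate [exp(-y) <= 1 - y + y^2] at [y = tau W^2]. By the hypothesis on [tau] the
    fourth-moment term is at most [tau v / 4], which leaves [1 - 3/4 tau v]. *)
Lemma subgaussian_expN_sq (tau : R) : 0 <= tau ->
  512 * rho ^+ 4 * tau * v <= 1 / 4 ->
  (\int[P]_x (expR (- (tau * W x ^+ 2)))%:E <= (expR (- (3 / 4 * tau * v)))%:E)%E.
Proof.
move=> tau0 tv.
have mE : measurable_fun setT (fun x => expR (- (tau * W x ^+ 2))).
  apply: measurableT_comp => //; apply: measurableT_comp => //.
  by apply: measurable_funM => //; exact: measurable_funX.
have e1 x : expR (- (tau * W x ^+ 2)) <= 1.
  by rewrite -[leRHS]expR0 ler_expR oppr_le0 mulr_ge0// sqr_ge0.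
have le1 : (\int[P]_x (expR (- (tau * W x ^+ 2)))%:E <= 1)%E.
  apply: (@le_trans _ _ (\int[P]_x cst 1%E x)%E).
    apply: ge0_le_integral => //.
    - exact/measurable_EFinP.
    - by move=> x _; rewrite lee_fin e1.
  by rewrite integral_cst//= probability_setT mule1.
(* For [v = 0] the trivial bound 1 is already the claim; otherwise [subgaussian_fourth] applies. *)
have := subgaussian_mom_ge0; rewrite le_eqVlt => /predU1P[<-|v0].
  by rewrite mulr0 oppr0 expR0.
have [i4 l4] := subgaussian_fourth v0.
have [i2 l2] := subgaussian_sq_integrable.
have E0 x : 0 <= expR (- (tau * W x ^+ 2)) by exact: expR_ge0.
have [iE _] := integrable_le_fin _ 1 mE E0 le1.
have it2 : P.-integrable setT (EFin \o (fun x => tau * W x ^+ 2)).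
  exact: (integrableZl measurableT tau i2).
have it4 : P.-integrable setT (EFin \o (fun x => tau ^+ 2 * W x ^+ 4)).
  exact: (integrableZl measurableT (tau ^+ 2) i4).
have i12 : P.-integrable setT (EFin \o (fun x => 1 - tau * W x ^+ 2)).
  exact: (integrableB measurableT (integrable_cst 1) it2).
have i124 : P.-integrable setT
    (EFin \o (fun x => 1 - tau * W x ^+ 2 + tau ^+ 2 * W x ^+ 4)).
  exact: (integrableD measurableT i12 it4).
have taylor (y : R) : 0 <= y -> expR (- y) <= 1 - y + y ^+ 2.
  move=> y0; apply: le_trans (expR_le_inv _ _) _; first by lra.
  by rewrite opprK -[leLHS]mul1r ler_pdivrMr; nra.
have -> : (\int[P]_x (expR (- (tau * W x ^+ 2)))%:E)%E =
    (\int[P]_x expR (- (tau * W x ^+ 2)))%:E.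
  by rewrite /Rintegral fineK//; exact: (integrable_fin_num measurableT iE).
rewrite lee_fin.
apply: (@le_trans _ _
    (\int[P]_x (1 - tau * W x ^+ 2 + tau ^+ 2 * W x ^+ 4))).
  apply: le_Rintegral => // x _.
  have -> : tau ^+ 2 * W x ^+ 4 = (tau * W x ^+ 2) ^+ 2 by ring.
  by apply: taylor; rewrite mulr_ge0// sqr_ge0.
rewrite RintegralD// RintegralB//; last exact: integrable_cst.
rewrite !RintegralZl// Rintegral_prob_cst l2.
apply: (@le_trans _ _ (1 + (- (3 / 4 * tau * v)))); last exact: expR_ge1Dx.
have : tau ^+ 2 * \int[P]_x (W x ^+ 4) <= tau ^+ 2 * (512 * rho ^+ 4 * v ^+ 2).
  by rewrite ler_wpM2l// sqr_ge0.
have -> : tau ^+ 2 * (512 * rho ^+ 4 * v ^+ 2) =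
  (512 * rho ^+ 4 * tau * v) * (tau * v) by ring.
have : 0 <= tau * v by rewrite mulr_ge0// ltW.
nra.
Qed.

End one_variable.

End subgaussian.

(** * Linear combinations of independent sub-Gaussian variables *)

Section linear_combinations.
Context {R : realType} {dT : measure_display} {T : measurableType dT}.
Variable P : probability T R.

(** Indices outside the image of [phi] receive the event [setT], of probability 1. *)
Lemma indep_rvs_sub {I J : finType} (phi : J -> I) (Z : I -> T -> R) :
  injective phi -> indep_rvs P Z -> indep_rvs P (Z \o phi).
Proof.
move=> phi_inj indZ B mB.
pose B' i := if [pick j | phi j == i] is Some j then B j else setT.
have B'phi j : B' (phi j) = B j.
  rewrite /B'; case: pickP => [k /eqP/phi_inj -> //|/(_ j)].
  by rewrite eqxx.
have B'out i : i \notin codom phi -> B' i = setT.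
  rewrite /B'; case: pickP => [k /eqP <-|//].
  by rewrite codom_f.
have := indZ B'; rewrite /indep_events => H.
have -> : \bigcap_(j in setT) ((Z \o phi) j @^-1` B j) =
    \bigcap_(i in setT) (Z i @^-1` B' i).
  apply/seteqP; split => [x h i _|x h j _]; last first.
    by have := h (phi j) Logic.I; rewrite B'phi.
  have [/codomP[j ->]|/B'out -> //] := boolP (i \in codom phi).
  by rewrite B'phi; exact: (h j).
rewrite H; last by move=> i; rewrite /B'; case: pickP.
rewrite (bigID (mem (codom phi)))/= [X in (_ * X)%E]big1 ?mule1; last first.
  by move=> i /B'out ->; rewrite preimage_setT probability_setT.
rewrite (eq_bigl (mem (phi @: predT))); last first.
  move=> i /=; apply/codomP/imsetP => [[j ->]|[j _ ->]].
    by exists j; rewrite ?inE.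
  by exists j.
rewrite big_imset/=; last by move=> j k _ _; exact: phi_inj.
by apply: eq_big => [j|j _]; rewrite ?inE ?B'phi.
Qed.

(** For each [i], the rectangles in the variables [Z j i] form a pi-system [G i]. These are
    independent over [i], and each combination is measurable for the sigma-algebra of [G i], so
    [indep_sigma] concludes. *)
Lemma indep_rvs_lincomb {I J : finType} (Z : J -> I -> T -> R) (theta : J -> R) :
  (forall j i, measurable_fun setT (Z j i)) ->
  indep_rvs P (fun p : J * I => Z p.1 p.2) ->
  indep_rvs P (fun i x => \sum_j theta j * Z j i x).
Proof.
move=> mZ indZ B mB.
pose G (i : I) : set (set T) := [set A | exists D : J -> set R,
  (forall j, measurable (D j)) /\ A = \bigcap_(j in setT) (Z j i @^-1` D j)].
have mpre j i (D : set R) : measurable D -> measurable (Z j i @^-1` D).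
  by move=> mD; rewrite -[X in measurable X]setTI; exact: mZ.
apply: (indep_sigma P G).
- move=> i _ _ [D [mD ->]] [D' [mD' ->]]; exists (fun j => D j `&` D' j).
  split=> [j|]; first exact: measurableI.
  apply/seteqP; split=> [x [h h'] j _|x h].
    by split; [exact: h|exact: h'].
  by split=> j _; have [] := h j Logic.I.
- move=> i; exists (fun=> setT); split=> //.
  by apply/seteqP; split.
- move=> i _ [D [mD ->]]; apply: fin_bigcap_measurable; first exact: finite_finset.
  by move=> j _; exact: mpre.
- move=> A /choice[D HD].
  have -> : A = fun i => \bigcap_(j in setT) (Z j i @^-1` D i j).
    by apply/funext => i; have [_ ->] := HD i.
  have mD i j : measurable (D i j) by have [] := HD i.
  have row i : P (\bigcap_(j in setT) (Z j i @^-1` D i j)) =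
      (\big[*%E/1%E]_(j : J) P (Z j i @^-1` D i j))%E.
    have inj : injective (fun j : J => (j, i)) by move=> j k [].
    exact: (indep_rvs_sub (fun j : J => (j, i)) _ inj indZ (D i) (mD i)).
  have := indZ (fun p => D p.2 p.1) (fun p => mD p.2 p.1).
  rewrite /indep_events => H; under eq_bigr do rewrite row.
  rewrite exchange_big/= pair_big/= -H; congr (P _).
  apply/seteqP; split=> [x h [j i] _|x h i _ j _]; first exact: h.
  exact: (h (j, i)).
- move=> i.
  (* The domain carries the sigma-algebra generated by [G i], so measurability of the sum says that
     its preimages lie in [<<s G i >>]. *)
  have mZG j : measurable_fun setT (Z j i : g_sigma_algebraType (G i) -> R).
    move=> _ D mD; rewrite setTI; apply: sub_sigma_algebra.
    exists (fun k => if k == j then D else setT); split=> [k|].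
      by case: eqP.
    apply/seteqP; split=> [x Dx k _|x h]; first by case: eqP => // ->.
    by have := h j Logic.I; rewrite eqxx.
  have mS : measurable_fun setT ((fun x => \sum_j theta j * Z j i x) :
      g_sigma_algebraType (G i) -> R).
    by apply: measurable_sum => j; apply: measurable_funM.
  by have := mS measurableT (B i) (mB i); rewrite setTI.
Qed.

Context {I : finType} (Z : I -> T -> R) (s : I -> R) (rho : R).
Hypothesis sgZ : forall i, subgaussian_mom P rho (Z i) (s i).
Hypothesis indZ : indep_rvs P Z.

Lemma integrable_subgaussianM (i k : I) :
  P.-integrable setT (EFin \o (fun x => Z i x * Z k x)).
Proof.
have [i1 _] := subgaussian_sq_integrable P _ _ _ (sgZ i).
have [i2 _] := subgaussian_sq_integrable P _ _ _ (sgZ k).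
have i12 : P.-integrable setT (EFin \o (fun x => Z i x ^+ 2 + Z k x ^+ 2)).
  exact: (integrableD measurableT i1 i2).
have mZ l : measurable_fun setT (Z l) by case: (sgZ l).
apply: le_integrable i12 => //.
  by apply/measurable_EFinP; exact: measurable_funM.
move=> x _; rewrite /= lee_fin [leRHS]ger0_norm ?addr_ge0 ?sqr_ge0// normrM.
rewrite -(real_normK (num_real (Z i x))) -(real_normK (num_real (Z k x))).
have := sqr_ge0 (`|Z i x| - `|Z k x|).
have := normr_ge0 (Z i x); have := normr_ge0 (Z k x); nra.
Qed.

(** Independence and zero means kill the cross terms, so second moments add up; the moment
    generating function factors. The same [rho] survives because the exponent is linear in the
    second moment. *)
Lemma subgaussian_lincomb (c : I -> R) :
  subgaussian_mom P rho (fun x => \sum_i c i * Z i x) (\sum_i c i ^+ 2 * s i).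
Proof.
have mZ l : measurable_fun setT (Z l) by case: (sgZ l).
have mc i : measurable_fun setT (fun x => c i * Z i x) by exact: measurable_funM.
split; first by apply: measurable_sum => i; exact: mc.
- have iik i k : P.-integrable setT
      (EFin \o (fun x => c i * c k * (Z i x * Z k x))).
    exact: (integrableZl measurableT (c i * c k) (integrable_subgaussianM i k)).
  have E x : (\sum_i c i * Z i x) ^+ 2 =
      \sum_i \sum_k c i * c k * (Z i x * Z k x).
    rewrite expr2 mulr_suml; apply: eq_bigr => i _; rewrite mulr_sumr.
    by apply: eq_bigr => k _; rewrite mulrACA.
  have irow i : P.-integrable setT
      (EFin \o (fun x => \sum_k c i * c k * (Z i x * Z k x))).
    exact: (integrable_sum_EFin P (index_enum I)
      (fun k x => c i * c k * (Z i x * Z k x))).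
  have iall := integrable_sum_EFin P (index_enum I) _ irow.
  under eq_integral do rewrite E.
  rewrite -[LHS]fineK; last exact: (integrable_fin_num measurableT iall).
  congr (_%:E).
  rewrite -[LHS]/(\int[P]_x (\sum_i \sum_k c i * c k * (Z i x * Z k x))).
  rewrite Rintegral_sum//; apply: eq_bigr => i _.
  rewrite (Rintegral_sum P _ (fun k x => c i * c k * (Z i x * Z k x)))//.
  rewrite (bigD1 i)//= big1 ?addr0.
    rewrite RintegralZl//; last exact: integrable_subgaussianM.
    have [_ <-] := subgaussian_sq_integrable P _ _ _ (sgZ i).
    by rewrite expr2; congr (_ * _); apply: eq_Rintegral => x _; rewrite expr2.
  move=> k ki; rewrite RintegralZl//; last exact: integrable_subgaussianM.
  rewrite RintegralM_indep//; last 2 first.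
  - by move=> l; exact: (subgaussian_integrable P _ _ _ (sgZ l)).
  - by rewrite eq_sym.
  by rewrite (subgaussian_mean0 P _ _ _ (sgZ i)) mul0r mulr0.
- move=> t.
  have mgf i := subgaussian_mgf P _ _ _ (sgZ i) (t * c i).
  pose V i := (fun y => expR (t * c i * y)) \o Z i.
  have mexp i : measurable_fun setT (fun y : R => expR (t * c i * y)).
    by apply: measurableT_comp => //; exact: measurable_funM.
  have Vfin i : (\int[P]_x (V i x)%:E)%E = (\int[P]_x V i x)%:E.
    rewrite /Rintegral fineK//; have [iV _] := mgf i.
    exact: (integrable_fin_num measurableT iV).
  under eq_integral do rewrite mulr_sumr expR_sum.
  have -> : (\int[P]_x (\prod_i expR (t * (c i * Z i x)))%:E =
      \int[P]_x (\prod_i V i x)%:E)%E.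
    apply: eq_integral => x _; congr (_%:E); apply: eq_bigr => i _.
    by rewrite /V/= mulrA.
  rewrite integral_prod_indep; last 4 first.
  - by move=> i; exact: measurableT_comp.
  - by move=> i x; exact: expR_ge0.
  - by move=> i; rewrite Vfin.
  - exact: (indep_rvs_comp P Z (fun i y => expR (t * c i * y))).
  rewrite (eq_bigr _ (fun i _ => Vfin i)) prodEFin lee_fin.
  rewrite mulr_sumr mulr_suml expR_sum; apply: ler_prod => i _.
  apply/andP; split; first by apply: Rintegral_ge0 => x _; exact: expR_ge0.
  have [_ le] := mgf i; apply: le_trans le _.
  by rewrite ler_expR exprMn; lra.
Qed.

End linear_combinations.

(** * Tail bounds for the form and the trace of the Gram matrix *)

Section tails.
Context {R : realType} {dT : measure_display} {T : measurableType dT}.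
Variable P : probability T R.

Lemma measurable_le_set (f g : T -> R) :
  measurable_fun setT f -> measurable_fun setT g ->
  measurable [set x | f x <= g x].
Proof.
move=> mf mg.
have mgf : measurable_fun setT (fun x => g x - f x) by exact: measurable_funB.
have := mgf measurableT _ (measurable_itv `[0, +oo[).
rewrite setTI; congr (measurable _); apply/seteqP; split => x /=.
  by rewrite in_itv/= andbT subr_ge0.
by rewrite in_itv/= andbT subr_ge0.
Qed.

Lemma markov_ge0 (f : T -> R) (a c : R) : measurable_fun setT f ->
  (forall x, 0 <= f x) -> 0 < a -> (\int[P]_x (f x)%:E <= c%:E)%E ->
  (P [set x | (a <= f x)%R] <= (c / a)%:E)%E.
Proof.
move=> mf f0 a0 fc.
have mf' : measurable_fun setT (EFin \o f) by exact/measurable_EFinP.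
have := le_integral_abse P measurableT mf' a0.
rewrite setTI (_ : [set x | _] = [set x | (a <= f x)%R]); last first.
  by apply/seteqP; split => x /=; rewrite lee_fin ger0_norm.
under eq_integral do rewrite /= ger0_norm//.
move=> /le_trans /(_ fc) aP.
have Pfin : P [set x | (a <= f x)%R] \is a fin_num.
  by rewrite fin_num_measure//; exact: measurable_le_set.
have : (a%:E * (fine (P [set x | (a <= f x)%R]))%:E <= c%:E)%E by rewrite fineK.
by rewrite -[in X in _ -> X](fineK Pfin) -EFinM !lee_fin ler_pdivlMr// mulrC.
Qed.

Lemma measure_le_union {F : eqType} (s : seq F) (A : F -> set T) (B : set T) :
  (forall f, measurable (A f)) -> measurable B ->
  (forall x, B x -> exists2 f, f \in s & A f x) ->
  (P B <= \sum_(f <- s) P (A f))%E.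
Proof.
move=> mA; elim: s B => [|g s IH] B mB BA.
  rewrite (_ : B = set0) ?measure0 ?big_nil//.
  by apply/seteqP; split => // x /BA[].
rewrite big_cons -(setDUK (@subIsetl _ B (A g))).
have mI : measurable (B `&` A g) by exact: measurableI.
have mD : measurable (B `\` (B `&` A g)) by exact: measurableD.
apply: le_trans (measureU2 _ mI mD) _; apply: leeD.
  by apply: le_measure; rewrite ?inE//; exact: subIsetr.
apply: IH => [//|x [Bx nA]].
have [f] := BA x Bx; rewrite inE => /predU1P[-> Ag|fs Af]; last by exists f.
by case: nA.
Qed.

Section array.
Context {m d : nat} (Z : 'I_m -> 'I_d -> T -> R) (s : 'I_d -> R) (rho : R).
Hypotheses (rho0 : 0 < rho) (s1 : forall i, s i <= 1).
Hypothesis sgZ : forall j i, subgaussian_mom P rho (Z j i) (s i).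
Hypothesis indZ : indep_rvs P (fun p : 'I_m * 'I_d => Z p.1 p.2).

Let mZ j i : measurable_fun setT (Z j i). Proof. by case: (sgZ j i). Qed.

Definition gram x : 'M[R]_m := \matrix_(j, k) \sum_i Z j i x * Z k i x.

Lemma gram_sym x : (gram x)^T = gram x.
Proof.
by apply/matrixP => j k; rewrite !mxE; apply: eq_bigr => i _; rewrite mulrC.
Qed.

Lemma qform_gram x v : qform (gram x) v = \sum_i (\sum_j v 0 j * Z j i x) ^+ 2.
Proof.
rewrite qformE.
under eq_bigr => j _ do under eq_bigr => k _ do rewrite mxE mulr_sumr mulr_suml.
under eq_bigr => j _ do rewrite exchange_big/=.
rewrite exchange_big/=; apply: eq_bigr => i _.
rewrite expr2 mulr_suml; apply: eq_bigr => j _.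
by rewrite mulr_sumr; apply: eq_bigr => k _; ring.
Qed.

Lemma measurable_qform_gram v : measurable_fun setT (fun x => qform (gram x) v).
Proof.
under eq_fun do rewrite qform_gram.
apply: measurable_sum => i; apply: measurable_funX.
by apply: measurable_sum => j; exact: measurable_funM.
Qed.

(** The value of [tau] with [512 rho^4 tau = 1/8]: [subgaussian_expN_sq] then covers second moments
    up to 2, that is [sqnorm v <= 2] and [s i <= 1]. *)
Definition lower_rate : R := (4096 * rho ^+ 4)^-1.

Lemma lower_rate_gt0 : 0 < lower_rate.
Proof. by rewrite invr_gt0 mulr_gt0 ?ltr0n ?exprn_gt0. Qed.

(** A Chernoff bound: [exp(- tau q)] is a product over [i] of independent factors, with mean at most
    [exp(- 3/4 tau N tr)]. Markov's inequality at level [exp(- tau N tr / 2)] leaves the rate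
    [3/4 - 1/2 = 1/4]. *)
Lemma gram_lower_tail (v : 'rV[R]_m) : sqnorm v <= 2 ->
  (P [set x | (qform (gram x) v <= sqnorm v * (\sum_i s i) / 2)%R] <=
   (expR (- (lower_rate * sqnorm v * (\sum_i s i) / 4)))%:E)%E.
Proof.
move=> v2; set N := sqnorm v; set tr := \sum_i s i; set tau := lower_rate.
have tau0 : 0 < tau by exact: lower_rate_gt0.
pose W i x := \sum_j v 0 j * Z j i x.
have N0 : 0 <= N by exact: sqnorm_ge0.
have sgW i : subgaussian_mom P rho (W i) (N * s i).
  have inj : injective (fun j : 'I_m => (j, i)) by move=> j k [].
  have ind := indep_rvs_sub P _ _ inj indZ.
  have := subgaussian_lincomb P (fun j => Z j i) (fun=> s i) rho
    (fun j => sgZ j i) ind (fun j => v 0 j).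
  by rewrite -mulr_suml.
have indW : indep_rvs P W by exact: indep_rvs_lincomb.
have mW i : measurable_fun setT (W i) by case: (sgW i).
have tauE : 512 * rho ^+ 4 * tau = 8^-1.
  rewrite /tau /lower_rate; field.
  by rewrite gt_eqF// exprn_gt0.
have le_i i := subgaussian_expN_sq P _ _ _ rho0 (sgW i) tau (ltW tau0).
have {}le_i i : (\int[P]_x (expR (- (tau * W i x ^+ 2)))%:E <=
    (expR (- (3 / 4 * tau * (N * s i))))%:E)%E.
  apply: le_i; rewrite tauE.
  have : N * s i <= N * 1 by apply: ler_wpM2l.
  by move: v2; rewrite -/N; lra.
pose V i := (fun y => expR (- (tau * y ^+ 2))) \o W i.
have mexp : measurable_fun setT (fun y : R => expR (- (tau * y ^+ 2))).
  apply: measurableT_comp => //; apply: measurableT_comp => //.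
  by apply: measurable_funM => //; exact: measurable_funX.
have mV i : measurable_fun setT (V i) by exact: measurableT_comp.
have intV i := integrable_le_fin P (V i) _ (mV i) (fun x => expR_ge0 _) (le_i i).
have Vfin i : (\int[P]_x (V i x)%:E)%E = (\int[P]_x V i x)%:E.
  rewrite /Rintegral fineK//; have [iV _] := intV i.
  exact: (integrable_fin_num measurableT iV).
pose F x := \prod_i V i x.
have F0 x : 0 <= F x by apply: prodr_ge0 => i _; exact: expR_ge0.
have FE x : F x = expR (- (tau * qform (gram x) v)).
  rewrite qform_gram mulr_sumr -sumrN expR_sum.
  by apply: eq_bigr.
have intF : (\int[P]_x (F x)%:E <= (expR (- (3 / 4 * tau * (N * tr))))%:E)%E.
  rewrite integral_prod_indep//.
  - rewrite (eq_bigr _ (fun i _ => Vfin i)) prodEFin lee_fin.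
    rewrite /tr !mulr_sumr -sumrN expR_sum; apply: ler_prod => i _.
    apply/andP; split; first by apply: Rintegral_ge0 => x _; exact: expR_ge0.
    by have [_] := intV i.
  - by move=> i x; exact: expR_ge0.
  - by move=> i; rewrite Vfin.
  - apply: (indep_rvs_comp P W (fun i y => expR (- (tau * y ^+ 2)))).
    + by [].
    + exact: indW.
have mF : measurable_fun setT F by exact: measurable_prod.
have := markov_ge0 F (expR (- (tau * (N * tr / 2)))) _ mF F0 (expR_gt0 _) intF.
rewrite -expRN -expRD opprK.
rewrite (_ : - (3 / 4 * tau * (N * tr)) + tau * (N * tr / 2) =
  - (tau * N * tr / 4)); last by field.
apply: le_trans; rewrite le_eqVlt; apply/orP; left; apply/eqP.
congr (P _); apply/seteqP; split => x /=.
  by rewrite FE ler_expR lerN2 ler_pM2l.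
by rewrite FE ler_expR lerN2 ler_pM2l.
Qed.

(** Markov's inequality: the expected trace is [m] times the sum of the [s i]. *)
Lemma gram_trace_tail (a : R) : 0 < a ->
  (P [set x | (a <= \sum_j gram x j j)%R] <= (m%:R * (\sum_i s i) / a)%:E)%E.
Proof.
move=> a0.
have gE x : \sum_j gram x j j = \sum_j \sum_i Z j i x ^+ 2.
  by apply: eq_bigr => j _; rewrite mxE; apply: eq_bigr => i _; rewrite expr2.
under eq_set do rewrite gE.
apply: markov_ge0 => //.
- apply: measurable_sum => j; apply: measurable_sum => i.
  exact: measurable_funX.
- by move=> x; apply: sumr_ge0 => j _; apply: sumr_ge0 => i _; rewrite sqr_ge0.
- under eq_integral do rewrite -sumEFin.
  rewrite ge0_integral_sum//; last 2 first.
  + move=> j; apply/measurable_EFinP; apply: measurable_sum => i.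
    exact: measurable_funX.
  + by move=> j x _; rewrite lee_fin sumr_ge0// => i _; rewrite sqr_ge0.
  under eq_bigr => j _.
    under eq_integral do rewrite -sumEFin.
    rewrite ge0_integral_sum//; last 2 first.
    + by move=> i; apply/measurable_EFinP; exact: measurable_funX.
    + by move=> i x _; rewrite lee_fin sqr_ge0.
    under eq_bigr => i _ do [case: (sgZ j i) => _ -> _].
    rewrite sumEFin; over.
  by rewrite sumEFin lee_fin sumr_const card_ord mulr_natl.
Qed.

End array.
End tails.

(** * Lattice net and union bound for the smallest eigenvalue *)

Section smallest_eigenvalue.
Context {R : realType} {dT : measure_display} {T : measurableType dT}.
Variable P : probability T R.
Context {m d : nat} (Z : 'I_m -> 'I_d -> T -> R) (s : 'I_d -> R) (rho : R).
Hypotheses (rho0 : 0 < rho) (s1 : forall i, s i <= 1) (m0 : (0 < m)%N).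
Hypothesis sgZ : forall j i, subgaussian_mom P rho (Z j i) (s i).
Hypothesis indZ : indep_rvs P (fun p : 'I_m * 'I_d => Z p.1 p.2).

(** By [le_lambda_min_int] the event is a countable intersection over integer vectors. *)
Lemma measurable_le_lambda_min (c : R) :
  measurable [set x | c <= lambda_min (gram Z x)].
Proof.
have mZ j i : measurable_fun setT (Z j i) by case: (sgZ j i).
have -> : [set x | c <= lambda_min (gram Z x)] =
    ~` (\bigcup_(n : {ffun 'I_m -> int}) ~` [set x |
      c * sqnorm (lattice_row 1 n : 'rV[R]_m) <= qform (gram Z x) (lattice_row 1 n)]).
  rewrite setC_bigcup; apply/seteqP; split => x /=.
    move=> /(le_lambda_min_int _ _ m0 (gram_sym Z x)) h n _.
    by rewrite setCK; exact: h.
  move=> h; apply/(le_lambda_min_int _ _ m0 (gram_sym Z x)) => n.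
  by have := h n Logic.I; rewrite setCK.
apply: measurableC; apply: countable_bigcupT_measurable => // n.
apply: measurableC; apply: measurable_le_set => //.
exact: (measurable_qform_gram P Z s rho sgZ).
Qed.

(** With [e = w - u], coordinatewise Young inequalities give [3/4 |u|^2 - 3 |e|^2 <= |w|^2 <= 5/4
    |u|^2 + 5 |e|^2], hence bounds [9/16] and [25/16]. *)
Lemma sqnorm_near_unit (h : R) (u w : 'rV[R]_m) : sqnorm u = 1 ->
  (forall j, `|w 0 j - u 0 j| <= h) -> m%:R * h ^+ 2 <= 1 / 16 ->
  1 / 2 <= sqnorm w <= 2.
Proof.
move=> u1 wu mh.
have e2 j : (w 0 j - u 0 j) ^+ 2 <= h ^+ 2.
  rewrite -real_normK ?num_real// lerXn2r ?nnegrE//.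
  exact: le_trans (wu j).
have sume : \sum_j (w 0 j - u 0 j) ^+ 2 <= 1 / 16.
  apply: le_trans mh; rewrite mulr_natl -[X in _ *+ X]card_ord -sumr_const.
  exact: ler_sum.
have lo : 3 / 4 * sqnorm u - 3 * (\sum_j (w 0 j - u 0 j) ^+ 2) <= sqnorm w.
  rewrite /sqnorm !mulr_sumr -sumrB; apply: ler_sum => j _.
  by have := sqr_ge0 (u 0 j / 2 + 2 * (w 0 j - u 0 j)); nra.
have hi : sqnorm w <= 5 / 4 * sqnorm u + 5 * (\sum_j (w 0 j - u 0 j) ^+ 2).
  rewrite /sqnorm !mulr_sumr -big_split/=; apply: ler_sum => j _.
  by have := sqr_ge0 (u 0 j / 2 - 2 * (w 0 j - u 0 j)); nra.
by rewrite u1 in lo hi; lra.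
Qed.

Lemma gram_lambda_min (eta : R) : 0 < eta -> eta < 1 ->
  m%:R <= (\sum_i s i) / 16 ->
  (32 / eta + 2) * (m%:R + 2 / eta) <= lower_rate rho * (\sum_i s i) / 8 ->
  ((1 - eta)%:E <= P [set x | (m%:R <= lambda_min (gram Z x))%R])%E.
Proof.
set tr := \sum_i s i => eta0 eta1 mtr rate.
have mR : 0 < m%:R :> R by rewrite ltr0n.
have tr0 : 0 < tr by lra.
pose h := Num.sqrt (eta / (16 * m%:R)).
have m16 : 0 < 16 * m%:R :> R by rewrite mulr_gt0// ltr0n.
have h2 : h ^+ 2 = eta / (16 * m%:R) by rewrite sqr_sqrtr// divr_ge0// ltW.
have h0 : 0 < h by rewrite sqrtr_gt0 divr_gt0.
have mh : m%:R * h ^+ 2 = eta / 16 by rewrite h2; field; rewrite gt_eqF.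
(* A point within [h] of a unit vector in each coordinate has integer coordinates at most
   [1 / h + 1] in absolute value, so the box contains it. *)
pose B := (Num.bound h^-1).+1.
have hB : h^-1 + 1 <= B%:R.
  rewrite /B -natr1 lerD2r ltW//; apply: archi_boundP.
  by rewrite invr_ge0 ltW.
pose n_of (f : {ffun 'I_m -> 'I_(2 * B).+1}) : 'I_m -> int :=
  fun j => centered_int B (f j).
pose w f : 'rV[R]_m := lattice_row h (n_of f).
pose S := [seq f <- index_enum {ffun 'I_m -> 'I_(2 * B).+1} |
  1 / 2 <= sqnorm (w f) <= 2].
(* With this threshold [gram_trace_tail] gives exactly [eta / 2]. *)
pose a := 2 / eta * m%:R * tr.
have a0 : 0 < a by rewrite !mulr_gt0// invr_gt0.
(* One family for the union bound: [None] is the event of a large trace, [Some f] that of a small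
   form at the lattice point [w f]. *)
pose A (o : option {ffun 'I_m -> 'I_(2 * B).+1}) : set T :=
  if o is Some f then
    [set x | qform (gram Z x) (w f) <= sqnorm (w f) * tr / 2]
  else [set x | a <= \sum_j gram Z x j j].
have mZ j i : measurable_fun setT (Z j i) by case: (sgZ j i).
have mq := measurable_qform_gram P Z s rho sgZ.
have mA o : measurable (A o).
  case: o => [f|]; apply: measurable_le_set => //.
  apply: measurable_sum => j; under eq_fun do rewrite mxE.
  by apply: measurable_sum => i; exact: measurable_funM.
set E := [set x | _].
have mE : measurable E by exact: measurable_le_lambda_min.
have cover x : (~` E) x -> exists2 o, o \in None :: map Some S & A o x.
  move=> nE; have [trx|trx] := leP a (\sum_j gram Z x j j).
    by exists None.
  have /existsNP[v /negP] : ~ forall v, m%:R * sqnorm v <= qform (gram Z x) v.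
    by move=> /(le_lambda_min _ _ m0 (gram_sym Z x)).
  rewrite -ltNge => qv.
  have v0 : 0 < sqnorm v.
    rewrite lt_neqAle sqnorm_ge0 andbT eq_sym; apply/eqP => /sqnorm_eq0 v0.
    by move: qv; rewrite v0 /qform !mul0mx mxE /sqnorm big1 ?mulr0 ?ltxx// => j _;
      rewrite mxE expr0n.
  pose u := (Num.sqrt (sqnorm v))^-1 *: v.
  have c2 : (Num.sqrt (sqnorm v))^-1 ^+ 2 = (sqnorm v)^-1.
    by rewrite exprVn sqr_sqrtr// ltW.
  have u1 : sqnorm u = 1 by rewrite sqnormZ c2 mulVf// gt_eqF.
  have qu : qform (gram Z x) u < m%:R.
    by rewrite qformZ c2 mulrC ltr_pdivrMr.
  have [n [nh qn]] := round_lattice (gram Z x) h u h0.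
  have u_le1 j : `|u 0 j| <= 1.
    rewrite -(@ler_pXn2r _ 2)// ?nnegrE// expr1n real_normK ?num_real// -u1.
    rewrite /sqnorm (bigD1 j)//= lerDl sumr_ge0// => k _.
    by rewrite sqr_ge0.
  have nB j : (- B%:Z <= n j <= B%:Z)%R.
    rewrite -ler_norml -(ler_int R) intr_norm; apply: le_trans hB.
    rewrite -(ler_pM2l h0) mulrDr mulfV ?gt_eqF// mulr1 -[X in X * _](gtr0_norm h0).
    rewrite -normrM -[h * _](subrK (u 0 j)) addrC.
    by apply: le_trans (ler_normD _ _) _; apply: lerD.
  pose f : {ffun 'I_m -> 'I_(2 * B).+1} := [ffun j => inord (absz (n j + B%:Z))].
  have fE j : n_of f j = n j.
    by rewrite /n_of ffunE centered_int_inord.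
  have wE : w f = lattice_row h n by apply/rowP => j; rewrite !mxE fE.
  have wn : 1 / 2 <= sqnorm (w f) <= 2.
    apply: (sqnorm_near_unit h u) => //; last by rewrite mh; lra.
    by move=> j; rewrite wE mxE.
  exists (Some f).
    by rewrite inE/= mem_map ?mem_filter ?wn ?mem_index_enum// => ? ? [].
  rewrite /A/= wE; apply: le_trans qn _; rewrite -wE.
  have -> : \sum_j `|gram Z x j j| = \sum_j gram Z x j j.
    apply: eq_bigr => j _; rewrite ger0_norm// mxE sumr_ge0// => i _.
    by rewrite -expr2 sqr_ge0.
  have : h ^+ 2 / 4 * (\sum_j gram Z x j j) <= h ^+ 2 / 4 * a.
    by apply: ler_wpM2l; [rewrite divr_ge0// sqr_ge0|exact: ltW].
  have -> : h ^+ 2 / 4 * a = tr / 32.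
    by rewrite h2 /a; field; rewrite !gt_eqF.
  (* The form at [w f] is at most [m + tr / 32 <= 3 tr / 32], while
     [sqnorm (w f) * tr / 2 >= tr / 4]. *)
  by case/andP: wn; nra.
have PD : (P (~` E) <= eta%:E)%E.
  apply: le_trans (measure_le_union P _ A _ mA (measurableC mE) cover) _.
  rewrite big_cons.
  have -> : eta = eta / 2 + eta / 2 by lra.
  rewrite EFinD; apply: leeD.
    apply: le_trans (gram_trace_tail P Z s rho sgZ a a0) _.
    rewrite lee_fin -/tr /a le_eqVlt; apply/orP; left; apply/eqP; field.
    by rewrite !gt_eqF.
  rewrite big_map big_filter.
  (* The bound of [gram_lower_tail] at the least admissible squared norm [1/2]. *)
  pose q := expR (- (lower_rate rho * tr / 8)).
  apply: (@le_trans _ _ (\sum_(f | (1 / 2 <= sqnorm (w f) <= 2)%R) q%:E)%E).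
    apply: lee_sum => f /andP[wlo whi].
    apply: le_trans (gram_lower_tail P Z s rho rho0 s1 sgZ indZ (w f) whi) _.
    rewrite lee_fin ler_expR lerN2 -/tr.
    have : 0 <= lower_rate rho * tr by rewrite mulr_ge0// ltW// lower_rate_gt0.
    nra.
  rewrite sumEFin lee_fin.
  have -> : \sum_(f | 1 / 2 <= sqnorm (w f) <= 2) q =
      (\sum_(f | 1 / 2 <= sqnorm (w f) <= 2) 1) * q.
    by rewrite mulr_suml; apply: eq_bigr => f _; rewrite mul1r.
  have q0 : 0 <= q by exact: expR_ge0.
  (* [sqnorm (w f) <= 2] bounds the squared norm of the integer vector by [2 / h^2 = 32 m / eta]. *)
  have cnt : \sum_(f | 1 / 2 <= sqnorm (w f) <= 2) (1 : R) <=
      expR (32 / eta * m%:R) * 3 ^+ m.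
    apply: le_trans (lattice_count m B (32 / eta * m%:R)).
    rewrite big_mkcond [leRHS]big_mkcond/=; apply: ler_sum => f _.
    case: ifP => [/andP[_ whi]|_]; last by case: ifP.
    rewrite ifT//.
    have wE : sqnorm (w f) = h ^+ 2 * \sum_j ((n_of f j)%:~R : R) ^+ 2.
      by rewrite /sqnorm mulr_sumr; apply: eq_bigr => j _; rewrite mxE exprMn.
    have h20 : 0 < h ^+ 2 by rewrite exprn_gt0.
    rewrite -(ler_pM2l h20) -wE; apply: le_trans whi _.
    rewrite h2 le_eqVlt; apply/orP; left; apply/eqP; field.
    by rewrite !gt_eqF.
  apply: le_trans (ler_wpM2r q0 cnt) _.
  have e3 : (3 : R) ^+ m <= expR (2 * m%:R).
    rewrite mulrC expRM_natl lerXn2r ?nnegrE ?expR_ge0//.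
    by have := expR_ge1Dx (2 : R); lra.
  apply: (@le_trans _ _ (expR (32 / eta * m%:R) * expR (2 * m%:R) * q)).
    by rewrite ler_wpM2r// ler_wpM2l// expR_ge0.
  rewrite /q -!expRD.
  (* By the rate hypothesis the total exponent is at most [- (32 / eta + 2) (2 / eta)], hence at
     most [- 2 / eta]; and [exp(- 2 / eta) <= eta / 2]. *)
  apply: (@le_trans _ _ (expR (- (2 / eta)))).
    rewrite ler_expR.
    have : 0 <= 32 / eta * (2 / eta) by rewrite mulr_ge0// divr_ge0// ltW.
    have : 0 <= 2 / eta by rewrite divr_ge0// ltW.
    nra.
  rewrite expRN -[leRHS]invrK lef_pV2 ?posrE ?expR_gt0 ?invr_gt0 ?divr_gt0//.
  by have := expR_ge1Dx (2 / eta); rewrite invf_div; lra.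
rewrite -[E]setCK probability_setC; last exact: measurableC.
have Pfin : P (~` E) \is a fin_num by rewrite fin_num_measure//; exact: measurableC.
rewrite -(fineK Pfin) -EFinB lee_fin lerB//.
by rewrite -lee_fin fineK.
Qed.

End smallest_eigenvalue.

(** * The sample in the coordinates of a common orthonormal basis *)

Section product_sample.
Context {R : realType} {dT : measure_display} {T : measurableType dT}.
Variable P : probability T R.
Context {m d : nat} (X : 'I_m -> T -> 'I_d -> R) (A : 'M[R]_d) (rho : R).
Hypothesis AAt : A *m A^T = 1%:M.

(** One matrix [A] serves the whole sample. Independence and sub-Gaussianity of the coordinates are
    assumed for the index [j0] only, and equality of laws carries them to the others. *)
Definition coords (j : 'I_m) (i : 'I_d) (w : T) : R := \sum_k A i k * X j w k.

Lemma borel_Rd_coords (B : 'I_d -> set R) : (forall i, measurable (B i)) ->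
  borel_Rd (\bigcap_(i in setT) [set v : 'I_d -> R | B i (\sum_k A i k * v k)]).
Proof.
(* [borel_Rd] is a bare family of sets; giving the space its generated sigma-algebra as a type makes
   the measurability of sums available. *)
move=> mB; pose U : pointedType := ('I_d -> measurableTypeR R)%type.
pose G : set (set U) := [set D | exists (k : 'I_d) (B : set R),
  measurable B /\ D = (fun v => v k) @^-1` B].
suff : measurable (\bigcap_(i in setT)
  [set v : g_sigma_algebraType G | B i (\sum_k A i k * v k)]) by [].
apply: fin_bigcap_measurable => [|i _]; first exact: finite_finset.
have mk k : measurable_fun setT ((fun v => v k) : g_sigma_algebraType G -> R).
  move=> _ D mD; rewrite setTI; apply: sub_sigma_algebra.
  by exists k, D.
have mS : measurable_fun setT ((fun v => \sum_k A i k * v k) : g_sigma_algebraType G -> R).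
  by apply: measurable_sum => k; exact: measurable_funM.
by have := mS measurableT _ (mB i); rewrite setTI.
Qed.

Hypothesis mX : forall j, rvec_measurable (X j).
Hypothesis indX : indep_rvecs P X.
Hypothesis idX : identically_distributed P X.
Variable j0 : 'I_m.
Hypothesis indY : indep_real_RVs P (coords j0).
Hypothesis sgY : forall i, subgaussian_rel P (coords j0 i) rho.

Lemma measurable_coords j i : measurable_fun setT (coords j i).
Proof.
by apply: measurable_sum => k; apply: measurable_funM => //; exact: mX.
Qed.

Lemma coords_cap_law j (B : 'I_d -> set R) : (forall i, measurable (B i)) ->
  P (\bigcap_(i in setT) (coords j i @^-1` B i)) =
  P (\bigcap_(i in setT) (coords j0 i @^-1` B i)).
Proof. by move=> mB; exact: (idX j j0 _ (borel_Rd_coords B mB)). Qed.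

Lemma coords_law j i (D : set R) : measurable D ->
  P (coords j i @^-1` D) = P (coords j0 i @^-1` D).
Proof.
move=> mD; pose B k := if k == i then D else setT.
have BE j' : \bigcap_(k in setT) (coords j' k @^-1` B k) = coords j' i @^-1` D.
  apply/seteqP; split => [x /(_ i Logic.I)|x Dx k _].
    by rewrite /B eqxx.
  by rewrite /B /=; case: eqP => // ->.
by rewrite -!BE; apply: coords_cap_law => k; rewrite /B; case: ifP.
Qed.

(** The probability splits over [j] by independence of the sample; each factor is moved to [j0] by
    equality of laws, split over [i] there, and moved back. *)
Lemma coords_indep : indep_rvs P (fun p : 'I_m * 'I_d => coords p.1 p.2).
Proof.
move=> B mB; rewrite /indep_events.
have -> : \bigcap_(p in setT) (coords p.1 p.2 @^-1` B p) =
    \bigcap_(j in setT) (X j @^-1`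
      \bigcap_(i in setT) [set v : 'I_d -> R | B (j, i) (\sum_k A i k * v k)]).
  apply/seteqP; split=> [x h j _ i _|x h [j i] _]; first exact: (h (j, i)).
  exact: (h j Logic.I i).
rewrite indX; last first.
  by move=> j; exact: (borel_Rd_coords (fun i => B (j, i)) (fun i => mB (j, i))).
transitivity (\big[*%E/1%E]_j \big[*%E/1%E]_i P (coords j i @^-1` B (j, i)));
  last first.
  by rewrite pair_bigA/=; apply: eq_bigr => -[j i] _.
apply: eq_bigr => j _.
transitivity (P (\bigcap_(i in setT) (coords j i @^-1` B (j, i)))) => //.
rewrite coords_cap_law// indY//.
by apply: eq_bigr => i _; rewrite coords_law.
Qed.

Definition second_mom (i : 'I_d) : R := fine 'E_P[fun w => (coords j0 i w ^+ 2)%R].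

Lemma integral_coords j i (f : R -> R) : measurable_fun setT f ->
  (forall x, 0 <= f x) ->
  (\int[P]_w (f (coords j i w))%:E = \int[P]_w (f (coords j0 i w))%:E)%E.
Proof.
move=> mf f0.
have mfE : measurable_fun setT (EFin \o f) by exact/measurable_EFinP.
have E j' : (\int[pushforward P (coords j' i)]_y (f y)%:E =
    \int[P]_w (f (coords j' i w))%:E)%E.
  rewrite (ge0_integral_pushforward (measurable_coords j' i))//.
  by move=> y _; rewrite /= lee_fin.
rewrite -!E; apply: eq_measure_integral; [exact: measurable_coords..|].
by move=> ? ? D mD _; exact: coords_law.
Qed.

Lemma coords_subgaussian j i : subgaussian_mom P rho (coords j i) (second_mom i).
Proof.
have [_ fin mgf] := sgY i.
split; first exact: measurable_coords.
- rewrite (integral_coords j i (fun y => y ^+ 2)); last 2 first.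
  + exact: measurable_funX.
  + by move=> y; rewrite sqr_ge0.
  rewrite /second_mom; move: fin; rewrite unlock => fin; rewrite fineK//.
  by rewrite ge0_fin_numE//; apply: integral_ge0 => w _; rewrite lee_fin sqr_ge0.
- move=> t; rewrite (integral_coords j i (fun y => expR (t * y))).
  + by have := mgf t; rewrite -/(second_mom i) unlock.
  + by apply: measurableT_comp => //; exact: measurable_funM.
  + by move=> y; exact: expR_ge0.
Qed.

Lemma AtA : A^T *m A = 1%:M. Proof. exact: mulmx1C. Qed.

(** The change of basis acts on the right of the sample matrix and cancels in
    [S A^T A S^T = S S^T]. *)
Lemma gram_coords w : gram coords w = sample_matrix X w *m (sample_matrix X w)^T.
Proof.
pose S := sample_matrix X w.
have -> : gram coords w = (S *m A^T) *m (S *m A^T)^T.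
  apply/matrixP => j k; rewrite !mxE; apply: eq_bigr => i _.
  by rewrite !mxE; congr (_ * _); apply: eq_bigr => l _; rewrite !mxE mulrC.
by rewrite trmx_mul trmxK mulmxA -(mulmxA S) AtA mulmx1.
Qed.

Lemma X_coords k w : X j0 w k = \sum_i A i k * coords j0 i w.
Proof.
pose x : 'cV[R]_d := \col_k X j0 w k.
have := congr1 (fun M => (M *m x) k 0) AtA; rewrite mul1mx -mulmxA !mxE => <-.
apply: eq_bigr => i _; rewrite !mxE; congr (_ * _).
by apply: eq_bigr => l _; rewrite !mxE.
Qed.

(** This supplies the zero means and the integrability behind the covariance formulas. *)
Lemma X_subgaussian k : subgaussian_mom P rho (fun w => X j0 w k)
  (\sum_i A i k ^+ 2 * second_mom i).
Proof.
under eq_fun do rewrite X_coords.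
exact: (subgaussian_lincomb P _ _ _ (coords_subgaussian j0) indY).
Qed.

Lemma cov_matrixE k l : cov_matrix P (X j0) k l = \int[P]_w (X j0 w k * X j0 w l).
Proof.
rewrite mxE covariance.unlock.
have mean0 k' : fine 'E_P[fun w => X j0 w k'] = 0.
  by rewrite unlock; exact: (subgaussian_mean0 P _ _ _ (X_subgaussian k')).
rewrite !mean0 unlock; congr fine; apply: eq_integral => w _.
by rewrite !fctE/= !subr0.
Qed.

Lemma qform_cov (v : 'rV[R]_d) :
  qform (cov_matrix P (X j0)) v = \int[P]_w ((\sum_k v 0 k * X j0 w k) ^+ 2).
Proof.
have iXX k l : P.-integrable setT (EFin \o (fun w => X j0 w k * X j0 w l)).
  exact: (integrable_subgaussianM P _ _ _ X_subgaussian).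
have icXX k l : P.-integrable setT
    (EFin \o (fun w => v 0 k * v 0 l * (X j0 w k * X j0 w l))).
  exact: (integrableZl measurableT (v 0 k * v 0 l) (iXX k l)).
rewrite qformE; transitivity (\sum_k \int[P]_w
    (\sum_l v 0 k * v 0 l * (X j0 w k * X j0 w l))).
  apply: eq_bigr => k _; rewrite Rintegral_sum//; apply: eq_bigr => l _.
  by rewrite RintegralZl// cov_matrixE mulrAC.
rewrite -Rintegral_sum; last first.
  move=> k; exact: (integrable_sum_EFin P _
    (fun l w => v 0 k * v 0 l * (X j0 w k * X j0 w l))).
apply: eq_Rintegral => w _; rewrite expr2 mulr_suml; apply: eq_bigr => k _.
by rewrite mulr_sumr; apply: eq_bigr => l _; rewrite mulrACA.
Qed.

Lemma second_momE i : \int[P]_w (coords j0 i w ^+ 2) = second_mom i.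
Proof. by have [] := subgaussian_sq_integrable P _ _ _ (coords_subgaussian j0 i). Qed.

(** The Loewner inequality is evaluated at row [i] of [A], a unit vector. *)
Lemma second_mom_le1 i :
  loewner_le (cov_matrix P (X j0)) 1%:M -> second_mom i <= 1.
Proof.
move=> /(_ (row i A)); rewrite -!/(qform _ _) qform_cov qform_scalar mul1r.
have -> : sqnorm (row i A) = 1.
  transitivity ((A *m A^T) i i); last by rewrite AAt mxE eqxx.
  by rewrite mxE; apply: eq_bigr => k _; rewrite !mxE expr2.
rewrite -second_momE; apply: le_trans; rewrite le_eqVlt; apply/orP; left.
apply/eqP/eq_Rintegral => w _; congr (_ ^+ 2).
by apply: eq_bigr => k _; rewrite mxE.
Qed.

(** The squared norm is the same in both bases pointwise, by a diagonal entry of [gram_coords]; then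
    integrate. *)
Lemma trace_cov : \tr (cov_matrix P (X j0)) = \sum_i second_mom i.
Proof.
rewrite /mxtrace; transitivity (\int[P]_w (\sum_k X j0 w k ^+ 2)).
  rewrite Rintegral_sum; last first.
    by move=> k; have [] := subgaussian_sq_integrable P _ _ _ (X_subgaussian k).
  apply: eq_bigr => k _; rewrite cov_matrixE.
  by apply: eq_Rintegral => w _; rewrite expr2.
transitivity (\int[P]_w (\sum_i coords j0 i w ^+ 2)).
  apply: eq_Rintegral => w _.
  transitivity (gram coords w j0 j0).
    by rewrite gram_coords mxE; apply: eq_bigr => k _; rewrite !mxE expr2.
  by rewrite mxE; apply: eq_bigr => i _; rewrite expr2.
rewrite Rintegral_sum; last first.
  by move=> i; have [] := subgaussian_sq_integrable P _ _ _ (coords_subgaussian j0 i).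
by apply: eq_bigr => i _; exact: second_momE.
Qed.

End product_sample.

(** * Choice of the constants and conclusion *)

Theorem mainTheorem16 (R : realType) (rho delta : R) :
  0 < rho -> 0 < delta < 1 ->
  exists beta C : R, 0 < beta /\ 0 < C /\
  forall (dT : measure_display) (T : measurableType dT) (P : probability T R)
         (d m : nat) (X : 'I_m -> T -> 'I_d -> R),
    (0 < m)%N ->
    (forall j, rvec_measurable (X j)) ->
    indep_rvecs P X ->
    identically_distributed P X ->
    (forall j, subgaussian_product P (X j) rho) ->
    (forall j, loewner_le (cov_matrix P (X j)) 1%:M) ->
    (forall j, m%:R <= beta * \tr (cov_matrix P (X j)) - C) ->
    (delta%:E <= P [set w | (m%:R <= lambda_min
                      (sample_matrix X w *m (sample_matrix X w)^T))%R])%E.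
Proof.
move=> rho0 /andP[delta0 delta1]; set eta := 1 - delta.
have eta0 : 0 < eta by rewrite subr_gt0.
have eta1 : eta < 1 by rewrite /eta; lra.
pose L := 32 / eta + 2.
have L0 : 0 < L by rewrite addr_gt0// divr_gt0.
have tau0 := lower_rate_gt0 rho rho0; set tau := lower_rate rho in tau0.
(* The first term gives [m <= tr / 16], the second [L (m + C) <= L beta tr <= tau tr / 8] with
   [C = 2 / eta]: the two numerical hypotheses of [gram_lambda_min]. *)
pose beta := Num.min (1 / 16) (tau / (8 * L)).
have beta0 : 0 < beta.
  by rewrite lt_min divr_gt0//= divr_gt0// mulr_gt0.
have betaL : L * beta <= tau / 8.
  apply: (@le_trans _ _ (L * (tau / (8 * L)))).
    by apply: ler_wpM2l; [exact: ltW|rewrite ge_min lexx orbT].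
  rewrite le_eqVlt; apply/orP; left; apply/eqP; field.
  by rewrite gt_eqF.
exists beta, (2 / eta); split=> //; split; first by rewrite divr_gt0.
move=> dT T P d m X m0 mX indX idX sgX covX trX.
(* The hypothesis gives each sample vector its own basis; the basis of [j0], which exists as
   [m > 0], is used for all. *)
pose j0 := Ordinal m0.
have [A [AAt [indY sgY]]] := sgX j0.
have trE := trace_cov P X A rho AAt mX idX j0 indY sgY.
have := trX j0; rewrite trE; set tr := \sum_i _ => mtr.
have C0 : 0 < 2 / eta by rewrite divr_gt0.
have tr0 : 0 <= tr.
  have : 0 <= beta * tr by have := ler0n R m; lra.
  by rewrite pmulr_rge0.
have b16 : beta <= 1 / 16 by rewrite ge_min lexx.
have le16 : m%:R <= tr / 16 by nra.
have rate : L * (m%:R + 2 / eta) <= tau * tr / 8.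
  apply: (@le_trans _ _ (L * (beta * tr))).
    by apply: ler_wpM2l; [exact: ltW|lra].
  by rewrite mulrA; nra.
have := gram_lambda_min P (coords X A) (second_mom P X A j0) rho rho0
  (fun i => second_mom_le1 P X A rho AAt mX idX j0 indY sgY i (covX j0)) m0
  (coords_subgaussian P X A rho mX idX j0 sgY)
  (coords_indep P X A indX idX j0 indY) eta eta0 eta1 le16 rate.
rewrite (_ : 1 - eta = delta); last by rewrite /eta; lra.
by under eq_set do rewrite (gram_coords X A AAt).
Qed.
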